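(* Let $d\geq 2$ be an integer, let $k\in\{0,1,\ldots,\lfloor d/2\rfloor\}$, let $M$ be a positive integer and let $q\in\mathbb{R}$. For every polytope $P_M\subset B_d$ with at most $M$ $k$-dimensional faces and with $o\in\operatorname{int}(P_M)$, the following hold. (i) If $0<|q|\leq d$, then \[ \widetilde\Delta_q(B_d,P_M)\geq\frac{1-e^{-1}}{2}\,\widetilde{V}_{|q|}(B_d)\,\min\left\{1,\ \frac{|q|}{2}\left(\frac{\omega_d}{4\kappa_{d-1}}\right)^{\frac{2}{d-1}}M^{-\frac{2}{d-1}}\right\}. \] (ii) If $|q|>d$, then \[ \widetilde\Delta_q(B_d,P_M)\geq\frac{1-e^{-1}}{2}\,\kappa_d\,\min\left\{1,\ \frac{|q|}{2}\left(\frac{\omega_d}{4\kappa_{d-1}}\right)^{\frac{2}{d-1}}M^{-\frac{2}{d-1}}\right\}. \] (iii) If $q=0$, then \[ \widehat\Delta_0(B_d,P_M)\geq\frac14\left(\frac{\omega_d}{4\kappa_{d-1}}\right)^{\frac{2}{d-1}}M^{-\frac{2}{d-1}}. \]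
   Context: $B_d$ is the Euclidean unit ball in $\mathbb{R}^d$ centered at the origin $o$, $\kappa_d=\operatorname{vol}_d(B_d)=\pi^{d/2}/\Gamma(\frac d2+1)$, and $\omega_d=\operatorname{vol}_{d-1}(\partial B_d)=d\kappa_d$. A polytope is the convex hull of finitely many points in $\mathbb{R}^d$. $\sigma$ is the normalized (probability) surface area measure on the unit sphere $\mathbb{S}^{d-1}$. $\mathcal{K}_o^d$ is the class of convex bodies in $\mathbb{R}^d$ containing the origin in their interiors, and for $K\in\mathcal{K}_o^d$ the radial function is $\rho_K(u)=\sup\{\lambda\geq 0:\lambda u\in K\}$, $u\in\mathbb{S}^{d-1}$. For $q\in[0,d]$ set \[ \widetilde{V}_q(B_d):=\pi^{\frac q2}\,\frac{\Gamma(d+1)}{\Gamma(q+1)\Gamma(d-q+1)}\cdot\frac{\Gamma\left(\frac{d-q}{2}+1\right)}{\Gamma\left(\frac d2+1\right)}. \] For $q\in\mathbb{R}\setminus\{0\}$ set $c_1(d,q):=\widetilde{V}_{|q|}(B_d)$ if $0<|q|\leq d$ and $c_1(d,q):=\kappa_d$ if $|q|>d$. For $K,L\in\mathcal{K}_o^d$ and $q\neq 0$, the $q$th dual volume deviation is \[ \widetilde{\Delta}_q(K,L):=c_1(d,q)\int_{\mathbb{S}^{d-1}}|\rho_K(u)^q-\rho_L(u)^q|\,d\sigma(u). \] For $q=0$, set $\widehat{V}_0(K):=\int_{\mathbb{S}^{d-1}}\ln\rho_K(u)\,d\sigma(u)$ and define the $0$th dual volume deviation by \[ \widehat{\Delta}_0(K,L):=\widehat{V}_0(K)+\widehat{V}_0(L)-2\widehat{V}_0(K\cap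 L). \] *)

(* Defs.v *)
From HB Require Import structures.
From mathcomp Require Import all_boot all_order all_algebra.
From mathcomp Require Import all_classical all_reals all_analysis.
From mathcomp Require Import measurable_realfun.

Set Implicit Arguments.
Unset Strict Implicit.
Unset Printing Implicit Defensive.

Import Order.TTheory GRing.Theory Num.Theory.
Import numFieldNormedType.Exports.

Local Open Scope classical_set_scope.
Local Open Scope ring_scope.

(* Points of R^n are row vectors 'rV[R]_n. Their standard topology is the
   product topology, but `|x| is the sup norm; the Euclidean norm is [enorm]. *)

Definition measure_rV_display : measure_display.
Proof. exact: default_measure_display. Qed.

(* 'rV[R]_n carries the sigma-algebra generated by the coordinate maps, as
   n.-tuple R does; since R is second countable this is the Borel
   sigma-algebra of R^n. *)
Section measurable_rV.
Context {R : realType} {n : nat}.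

Definition rV_coord (i : 'I_n) (x : 'rV[R]_n) : measurableTypeR R := x 0 i.

Let rV_set0 : g_sigma_preimage rV_coord set0.
Proof. exact: sigma_algebra0. Qed.

Let rV_setC A : g_sigma_preimage rV_coord A ->
  g_sigma_preimage rV_coord (~` A).
Proof. exact: sigma_algebraC. Qed.

Let rV_bigcup (F : (set _)^nat) : (forall i, g_sigma_preimage rV_coord (F i)) ->
  g_sigma_preimage rV_coord (\bigcup_i (F i)).
Proof. exact: sigma_algebra_bigcup. Qed.

HB.instance Definition _ := @isMeasurable.Build measure_rV_display
  'rV[R]_n (g_sigma_preimage rV_coord) rV_set0 rV_setC rV_bigcup.

End measurable_rV.

Section measurable_fun_rV.
Context {R : realType}.

Lemma measurable_rV_coord n (i : 'I_n) :
  measurable_fun [set: 'rV[R]_n] (rV_coord i).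
Proof.
move=> _ Y mY; rewrite setTI; apply: sub_sigma_algebra => /=.
rewrite -bigcup_seq/=; exists i => /=; first by rewrite mem_index_enum.
by exists Y => //; rewrite setTI.
Qed.

Lemma measurable_fun_rV (d : measure_display) (T : measurableType d) n (f : T -> 'rV[R]_n) :
  (forall i, measurable_fun setT (rV_coord i \o f)) -> measurable_fun setT f.
Proof.
move=> mf.
suff : g_sigma_preimage (fun i => rV_coord i \o f) `<=` measurable.
  rewrite g_sigma_preimage_comp => prefS _ A mA.
  by apply: prefS; exists A.
apply: smallest_sub; first exact: sigma_algebra_measurable.
rewrite -bigcup_seq; apply: bigcup_sub => i _ A [B mB <-].
exact: mf.
Qed.

End measurable_fun_rV.

Section lebesgue_rV.
Context {R : realType}.

Definition rV_cons n (p : measurableTypeR R * 'rV[R]_n) : 'rV[R]_n.+1 :=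
  \row_i if unlift ord0 i is Some j then p.2 0 j else p.1.

Lemma measurable_rV_cons n : measurable_fun setT (@rV_cons n).
Proof.
apply: measurable_fun_rV => i.
rewrite (_ : _ \o _ = fun p => if unlift ord0 i is Some j
  then rV_coord j p.2 else p.1); last first.
  by apply/funext => p /=; rewrite /rV_coord mxE.
case: (unlift ord0 i) => [j|]; last exact: measurable_fst.
by apply: measurableT_comp; [exact: measurable_rV_coord|exact: measurable_snd].
Qed.

HB.instance Definition _ n :=
  isMeasurableFun.Build _ _ _ _ (@rV_cons n) (@measurable_rV_cons n).

Section lebesgue_rV_step.
Context {n : nat} (m : {sigma_finite_measure set 'rV[R]_n -> \bar R}).
Local Open Scope ereal_scope.

Definition lebesgue_rV_step : set 'rV[R]_n.+1 -> \bar R :=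
  pushforward (@lebesgue_measure R \x m) (@rV_cons n).

Let step0 : lebesgue_rV_step set0 = 0.
Proof. exact: measure0. Qed.

Let step_ge0 A : 0 <= lebesgue_rV_step A.
Proof. exact: measure_ge0. Qed.

Let step_sigma_additive : semi_sigma_additive lebesgue_rV_step.
Proof. exact: measure_semi_sigma_additive. Qed.

HB.instance Definition _ := isMeasure.Build _ _ _ lebesgue_rV_step
  step0 step_ge0 step_sigma_additive.

Let step_sigma_finite : sigma_finite setT lebesgue_rV_step.
Proof.
have /sigma_finiteP[F [FT ndF Foo]] := sigma_finiteT (@lebesgue_measure R).
have /sigma_finiteP[G [GT ndG Goo]] := sigma_finiteT m.
pose tl (x : 'rV[R]_n.+1) : 'rV[R]_n := \row_j x 0%R (lift ord0 j).
have mtl : measurable_fun setT tl.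
  apply: measurable_fun_rV => i.
  rewrite (_ : _ \o _ = rV_coord (lift ord0 i)).
    exact: measurable_rV_coord.
  by apply/funext => x /=; rewrite /rV_coord mxE.
have mhd : measurable_fun setT (@rV_coord R n.+1 ord0).
  exact: measurable_rV_coord.
have hdK p : rV_coord ord0 (@rV_cons n p) = p.1.
  by rewrite /rV_coord mxE unlift_none.
have tlK p : tl (@rV_cons n p) = p.2.
  by apply/rowP => j; rewrite !mxE liftK.
exists (fun k => rV_coord ord0 @^-1` F k `&` tl @^-1` G k) => [|k].
  apply/esym; rewrite -subTset => x _.
  have [i _ Fi] : (\bigcup_i F i) (rV_coord ord0 x) by rewrite -FT.
  have [j _ Gj] : (\bigcup_i G i) (tl x) by rewrite -GT.
  exists (maxn i j) => //; split.
    by have /subsetPset := ndF _ _ (leq_maxl i j); apply.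
  by have /subsetPset := ndG _ _ (leq_maxr i j); apply.
have [mF Fk] := Foo k; have [mG Gk] := Goo k; split.
  apply: measurableI; rewrite -[X in measurable X]setTI; [exact: mhd|exact: mtl].
rewrite /lebesgue_rV_step /pushforward.
rewrite (_ : _ @^-1` _ = F k `*` G k); last first.
  by apply/seteqP; split=> p /=; rewrite hdK tlK.
by rewrite product_measure1E// lte_mul_pinfty// ge0_fin_numE.
Qed.

HB.instance Definition _ := Measure_isSigmaFinite.Build _ _ _ lebesgue_rV_step
  step_sigma_finite.

End lebesgue_rV_step.

(* Lebesgue measure vol_n on R^n, as the n-fold product of Lebesgue measure
   on R (a unit point mass when n = 0). *)
Fixpoint lebesgue_rV n : {sigma_finite_measure set 'rV[R]_n -> \bar R} :=
  match n with
  | 0 => [the {sigma_finite_measure set 'rV[R]_0 -> \bar R} of \d_(0 : 'rV[R]_0)]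
  | n'.+1 => [the {sigma_finite_measure set 'rV[R]_n'.+1 -> \bar R} of
               lebesgue_rV_step (lebesgue_rV n')]
  end.

Lemma lebesgue_rV_box n (A : 'I_n -> set (measurableTypeR R)) :
  (forall i, measurable (A i)) ->
  lebesgue_rV n [set x | forall i, A i (x 0 i)] =
  (\prod_i lebesgue_measure (A i))%E.
Proof.
elim: n A => [|n IH] A mA /=.
  rewrite big_ord0 diracE mem_set//= => i.
  by case: i.
rewrite big_ord_recl -IH => [|i]; last exact: mA.
rewrite -product_measure1E//; last first.
  rewrite [X in measurable X](_ : _ =
      \bigcap_(i in setT) (rV_coord i @^-1` A (lift ord0 i))).
    apply: fin_bigcap_measurable => [|i _]; first exact: finite_finset.
    by rewrite -[X in measurable X]setTI; apply: measurable_rV_coord.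
  by apply/seteqP; split=> x /= h i; [move=> _|]; exact: h.
congr (product_measure1 _ _ _); apply/seteqP; split=> p /=.
  move=> h; split; first by have := h ord0; rewrite mxE unlift_none.
  by move=> i; have := h (lift ord0 i); rewrite mxE liftK.
by move=> [h0 h] i; rewrite mxE; case: unliftP => [j ->|->].
Qed.

End lebesgue_rV.

Section euclidean.
Context {R : realType} {d : nat}.
Implicit Types x y : 'rV[R]_d.

Definition dotv x y : R := \sum_i x 0 i * y 0 i.

Definition enorm x : R := Num.sqrt (dotv x x).

Definition eball : set 'rV[R]_d := [set x | enorm x <= 1].

Definition esphere : set 'rV[R]_d := [set x | enorm x = 1].

(* equal to 0 at the origin *)
Definition direction x : 'rV[R]_d := (enorm x)^-1 *: x.

Lemma measurable_enorm : measurable_fun setT enorm.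
Proof.
apply: (@measurableT_comp _ _ _ _ _ _ (@Num.sqrt R)) => //.
  by apply: continuous_measurable_fun; exact: sqrt_continuous.
apply: measurable_sum => i.
by apply: measurable_funM; exact: measurable_rV_coord.
Qed.

Lemma measurable_eball : measurable eball.
Proof.
rewrite (_ : eball = setT `&` enorm @^-1` [set` `]-oo, 1%R]]).
  by apply: measurable_enorm.
by apply/seteqP; split=> x /=; rewrite in_itv /=; [|case].
Qed.

Lemma measurable_direction : measurable_fun setT direction.
Proof.
apply: measurable_fun_rV => i.
rewrite (_ : _ \o _ = (fun x => (enorm x)^-1 * rV_coord i x)); last first.
  by apply/funext => x; rewrite /= /rV_coord mxE.
apply: measurable_funM; last exact: measurable_rV_coord.
rewrite (_ : (fun _ => _) = (fun x => enorm x `^ (-1))); last first.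
  by apply/funext => x; rewrite powR_inv1// sqrtr_ge0.
apply: (@measurableT_comp _ _ _ _ _ _ (@powR R ^~ (-1))) => //.
exact: measurable_enorm.
Qed.

HB.instance Definition _ :=
  isMeasurableFun.Build _ _ _ _ direction measurable_direction.

End euclidean.
Arguments eball {R d}.
Arguments esphere {R d}.

Section constants.
Context {R : realType}.

Definition kappa (n : nat) : R := fine (lebesgue_rV n (@eball R n)).

(* vol_{n-1} of the boundary of B_n; see [sphere_prob] *)
Definition omega (n : nat) : R := n%:R * kappa n.

Lemma kappa_ge0 n : 0 <= kappa n.
Proof. by rewrite /kappa fine_ge0. Qed.

Lemma eball_sub_box n :
  (@eball R n) `<=` [set x : 'rV[R]_n | forall i, `[-1, 1]%classic (x 0 i)].
Proof.
move=> x /= x1 i; rewrite in_itv /= -ler_norml -sqrtr_sqr.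
apply: le_trans x1; rewrite ler_wsqrtr// /dotv (bigD1 i)//= -expr2 lerDl.
by apply: sumr_ge0 => j _; rewrite -expr2 sqr_ge0.
Qed.

Lemma box_sub_eball n :
  [set x : 'rV[R]_n | forall i, `[0, n.+1%:R^-1]%classic (x 0 i)] `<=` @eball R n.
Proof.
move=> x /= xn; rewrite /eball /= /enorm -[leRHS]sqrtr1 ler_wsqrtr// /dotv.
apply: (@le_trans _ _ (\sum_(i < n) n.+1%:R^-1)); last first.
  rewrite sumr_const card_ord -[_ *+ _]mulr_natl ler_pdivrMr ?ltr0n// mul1r.
  by rewrite ler_nat.
apply: ler_sum => i _; have := xn i; rewrite in_itv /= => /andP[x0 xi].
have xi1 : x 0 i <= 1 by apply: le_trans xi _; rewrite invf_le1 ?ltr0n// ler1n.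
by apply: le_trans xi; rewrite ler_piMl.
Qed.

Lemma measurable_box n (A : set (measurableTypeR R)) : measurable A ->
  measurable [set x : 'rV[R]_n | forall i, A (x 0 i)].
Proof.
move=> mA; rewrite [X in measurable X](_ : _ =
    \bigcap_(i in setT) (rV_coord i @^-1` A)).
  apply: fin_bigcap_measurable => [|i _]; first exact: finite_finset.
  by rewrite -[X in measurable X]setTI; apply: measurable_rV_coord.
by apply/seteqP; split=> x /= h i; [move=> _|]; exact: h.
Qed.

Lemma kappaE n : (kappa n)%:E = lebesgue_rV n (@eball R n).
Proof.
rewrite /kappa fineK// ge0_fin_numE//.
have mI : measurable (`[-1, 1]%classic : set (measurableTypeR R)) by [].
apply: (@le_lt_trans _ _ (lebesgue_rV n
    [set x : 'rV[R]_n | forall i, `[-1, 1]%classic (x 0 i)])).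
  apply: le_measure; rewrite ?inE; [exact: measurable_eball|exact: measurable_box|].
  exact: eball_sub_box.
rewrite (lebesgue_rV_box (fun=> mI)).
rewrite (eq_bigr (fun=> (2 : R)%:E)); first by rewrite prodEFin ltry.
by move=> i _; rewrite lebesgue_measure_itv /= lte_fin gtrN// -EFinB opprK.
Qed.

Lemma kappa_gt0 n : 0 < kappa n.
Proof.
rewrite -lte_fin kappaE.
have mI : measurable (`[0, n.+1%:R^-1]%classic : set (measurableTypeR R)) by [].
apply: (@lt_le_trans _ _ (lebesgue_rV n
    [set x : 'rV[R]_n | forall i, `[0, n.+1%:R^-1]%classic (x 0 i)])); last first.
  apply: le_measure; rewrite ?inE; [exact: measurable_box|exact: measurable_eball|].
  exact: box_sub_eball.
rewrite (lebesgue_rV_box (fun=> mI)).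
rewrite (eq_bigr (fun=> (n.+1%:R^-1 : R)%:E)).
  by rewrite prodEFin lte_fin prodr_gt0// => i _; rewrite invr_gt0 ltr0n.
by move=> i _; rewrite lebesgue_measure_itv /= lte_fin invr_gt0 ltr0n/= sube0.
Qed.

Definition Gamma (x : R) : R :=
  Rintegral (@lebesgue_measure R) `]0, +oo[ (fun t => t `^ (x - 1) * expR (- t)).

(* The q-th dual volume of B_d, for 0 <= q <= d. *)
Definition dual_vol_ball (d : nat) (q : R) : R :=
  pi `^ (q / 2) *
  (Gamma (d%:R + 1) / (Gamma (q + 1) * Gamma (d%:R - q + 1))) *
  (Gamma ((d%:R - q) / 2 + 1) / Gamma (d%:R / 2 + 1)).

Definition c1 (d : nat) (q : R) : R :=
  if `|q| <= d%:R then dual_vol_ball d `|q| else kappa d.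

End constants.

Section sphere_measure.
Context {R : realType} {d : nat}.
Local Open Scope ereal_scope.

(* The surface area of a Borel subset A of the unit sphere is
   d * vol_d {x in B_d | x <> 0 and x / |x| in A}; dividing by
   omega d = d * kappa d gives the normalized surface area measure. Here it is
   a measure on R^d, concentrated on [esphere] by [sphere_prob_esphere]. *)
Definition sphere_prob (A : set 'rV[R]_d) : \bar R :=
  ((kappa d)^-1)%:E * lebesgue_rV d (direction @^-1` A `&` eball).

Let kappaV_ge0 : (0 <= (kappa d)^-1 :> R)%R.
Proof. by rewrite invr_ge0 kappa_ge0. Qed.

Let cone_measure : set 'rV[R]_d -> \bar R :=
  pushforward (mrestr (lebesgue_rV d) measurable_eball) direction.

Let cone_measure0 : cone_measure set0 = 0.
Proof. exact: measure0. Qed.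

Let cone_measure_ge0 A : 0 <= cone_measure A.
Proof. exact: measure_ge0. Qed.

Let cone_measure_sigma_additive : semi_sigma_additive cone_measure.
Proof. exact: measure_semi_sigma_additive. Qed.

HB.instance Definition _ := isMeasure.Build _ _ _ cone_measure
  cone_measure0 cone_measure_ge0 cone_measure_sigma_additive.

Let sphere_prob0 : sphere_prob set0 = 0.
Proof. exact: (measure0 (mscale (NngNum kappaV_ge0) cone_measure)). Qed.

Let sphere_prob_ge0 A : 0 <= sphere_prob A.
Proof. exact: (measure_ge0 (mscale (NngNum kappaV_ge0) cone_measure)). Qed.

Let sphere_prob_sigma_additive : semi_sigma_additive sphere_prob.
Proof.
exact: (@measure_semi_sigma_additive _ _ _
  (mscale (NngNum kappaV_ge0) cone_measure)).
Qed.

HB.instance Definition _ := isMeasure.Build _ _ _ sphere_prob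
  sphere_prob0 sphere_prob_ge0 sphere_prob_sigma_additive.

Lemma sphere_prob_setT : sphere_prob [set: 'rV[R]_d] = 1.
Proof.
rewrite /sphere_prob preimage_setT setTI -kappaE -EFinM mulVf//.
by rewrite gt_eqF// kappa_gt0.
Qed.

Lemma sphere_prob_esphere : (0 < d)%N -> sphere_prob (@esphere R d) = 1.
Proof.
move=> d0; pose i0 := Ordinal d0.
have mS : measurable (@esphere R d).
  rewrite (_ : esphere = setT `&` enorm @^-1` [set 1%R]).
    by apply: measurable_enorm.
  by rewrite setTI.
have mI : measurable ([set 0%R] : set (measurableTypeR R)) by [].
have box0 : lebesgue_rV d [set x : 'rV[R]_d | forall i, [set 0%R] (x 0%R i)] = 0.
  by rewrite (lebesgue_rV_box (fun=> mI)) (bigD1 i0)//= lebesgue_measure_set1 mul0e.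
have SC0 : sphere_prob (~` esphere) = 0.
  apply/eqP; rewrite eq_le measure_ge0 andbT -(mule0 (kappa d)^-1%:E).
  rewrite /sphere_prob lee_pmul2l//= ?lte_fin ?invr_gt0 ?kappa_gt0//.
  rewrite -box0 le_measure// ?inE.
  - apply: measurableI; last exact: measurable_eball.
    rewrite -[X in measurable X]setTI; apply: measurable_direction => //.
    exact: measurableC.
  - exact: measurable_box.
  - move=> x [/= xS _] i; apply: contrapT => xi; apply: xS.
    have x_gt0 : (0 < dotv x x)%R.
      rewrite /dotv (bigD1 i)//= -expr2 ltr_wpDr//.
        by apply: sumr_ge0 => j _; rewrite -expr2 sqr_ge0.
      by rewrite exprn_even_gt0//; apply/eqP.
    suff : dotv (direction x) (direction x) = 1%R.
      by move=> dx1; rewrite /esphere /= {1}/enorm dx1 sqrtr1.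
    rewrite /dotv; under eq_bigr do rewrite !mxE mulrACA.
    rewrite -mulr_sumr -/(dotv x x) -expr2 exprVn sqr_sqrtr ?ltW// mulVf//.
    by rewrite gt_eqF.
rewrite -sphere_prob_setT -(setUv esphere) measureU ?setICr//.
  by rewrite [X in _ + X]SC0 adde0.
exact: measurableC.
Qed.

End sphere_measure.

Section dual_volumes.
Context {R : realType} {d : nat}.
Implicit Types K L : set 'rV[R]_d.

Definition radial K (u : 'rV[R]_d) : R :=
  sup [set lambda : R | 0 <= lambda /\ K (lambda *: u)].

Definition sphere_mean (f : 'rV[R]_d -> R) : R :=
  Rintegral (@sphere_prob R d) esphere f.

(* The q-th dual volume deviation, for q <> 0. *)
Definition dual_dev (q : R) K L : R :=
  c1 d q * sphere_mean (fun u => `|radial K u `^ q - radial L u `^ q|).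

Definition dual_vol0 K : R := sphere_mean (fun u => ln (radial K u)).

Definition dual_dev0 K L : R :=
  dual_vol0 K + dual_vol0 L - 2 * dual_vol0 (K `&` L).

End dual_volumes.

Section polytopes.
Context {R : realType} {d : nat}.
Implicit Types A F P : set 'rV[R]_d.

Definition conv_hull A : set 'rV[R]_d :=
  smallest (fun B : set 'rV[R]_d => convex_set B) A.

Definition is_polytope P := exists2 A, finite_set A & P = conv_hull A.

Definition is_affine A :=
  forall x y (t : R), A x -> A y -> A ((1 - t) *: x + t *: y).

Definition aff_hull A : set 'rV[R]_d := smallest is_affine A.

(* F is nonempty and its affine hull is a translate of a k-dimensional linear
   subspace. *)
Definition has_dim A (k : nat) :=
  exists (x : 'rV[R]_d) (U : {vspace 'rV[R]_d}),
    aff_hull A = [set x + u | u in [set u | u \in U]] /\ \dim U = k.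

(* a = 0 gives the improper faces P and set0. *)
Definition is_face P F :=
  exists (a : 'rV[R]_d) (b : R),
    (forall x, P x -> dotv a x <= b) /\ F = P `&` [set x | dotv a x = b].

Definition faces (k : nat) P : set (set 'rV[R]_d) :=
  [set F | is_face P F /\ has_dim F k].

End polytopes.

(* Main.v *)
(* P is the convex hull of a finite set; let V be its set of exposed points.

   Counting. Fix a generic linear functional l, let v be in V, and let X be the
   set of edge directions at v. A vertex a of the polyhedron
   {a | a.x >= max(0, - l.x) for all x in X} yields two faces of the cone at v,
   the zero sets of a and of a + l, on which l > 0 and l < 0 respectively, whose
   dimensions add up to at least d. Since k <= d/2, at least two pairs (k-face F,
   sign s) are such that v is the unique minimum of s l over F. As (F, s)
   determines v, P has at least |V| faces of dimension k, so |V| <= M.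

   Measure. Let b = omega_d / (4 kappa_(d-1) M), r = b^(1/(d-1)), t = r^2 / 2.
   A spherical cap of chord r has probability at most
   2 kappa_(d-1) r^(d-1) / omega_d = 1 / (2M), because the sector over it is
   covered by two cones with a common base; orthogonal invariance of Lebesgue
   measure reduces this to caps around a coordinate axis. If u lies outside the
   caps around the points of V, which happens with probability at least 1/2, then
   rho_P(u) <= max_V u.v <= 1 - t, and the integrands are bounded below by
   (1 - 1/e) min(1, |q| t), respectively by t. *)

Require Import Defs.
From HB Require Import structures.
From mathcomp Require Import all_boot all_order all_algebra.
From mathcomp Require Import all_classical all_reals all_analysis.
From mathcomp Require Import measurable_realfun ring lra zify.

Set Implicit Arguments.
Unset Strict Implicit.
Unset Printing Implicit Defensive.

Import Order.TTheory GRing.Theory Num.Theory.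
Import numFieldNormedType.Exports.

Local Open Scope classical_set_scope.
Local Open Scope ring_scope.

(** * Polyhedral cones and face numbers *)

Section dot_product.
Context {R : realType} {d : nat}.
Implicit Types x y z : 'rV[R]_d.

Lemma dotvC x y : dotv x y = dotv y x.
Proof. by apply: eq_bigr => i _; rewrite mulrC. Qed.

Lemma dotvDr x y z : dotv x (y + z) = dotv x y + dotv x z.
Proof. by rewrite -big_split; apply: eq_bigr => i _; rewrite mxE mulrDr. Qed.

Lemma dotvZr a x y : dotv x (a *: y) = a * dotv x y.
Proof. by rewrite big_distrr; apply: eq_bigr => i _; rewrite mxE mulrCA. Qed.

Lemma dotvDl x y z : dotv (y + z) x = dotv y x + dotv z x.
Proof. by rewrite dotvC dotvDr !(dotvC x). Qed.

Lemma dotvZl a x y : dotv (a *: y) x = a * dotv y x.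
Proof. by rewrite dotvC dotvZr (dotvC x). Qed.

Lemma dotvNr x y : dotv x (- y) = - dotv x y.
Proof. by rewrite -scaleN1r dotvZr mulN1r. Qed.

Lemma dotvNl x y : dotv (- x) y = - dotv x y.
Proof. by rewrite dotvC dotvNr dotvC. Qed.

Lemma dotvBr x y z : dotv x (y - z) = dotv x y - dotv x z.
Proof. by rewrite dotvDr dotvNr. Qed.

Lemma dotvBl x y z : dotv (y - z) x = dotv y x - dotv z x.
Proof. by rewrite dotvDl dotvNl. Qed.

Lemma dotv0r x : dotv x 0 = 0.
Proof. by rewrite -(scale0r 0) dotvZr mul0r. Qed.

Lemma dotv0l x : dotv 0 x = 0.
Proof. by rewrite dotvC dotv0r. Qed.

Lemma dotv_ge0 x : 0 <= dotv x x.
Proof. by apply: sumr_ge0 => i _; rewrite -expr2 sqr_ge0. Qed.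

Lemma dotv_eq0 x : (dotv x x == 0) = (x == 0).
Proof.
apply/eqP/eqP => [|->]; last by rewrite dotv0r.
rewrite /dotv => /eqP; rewrite psumr_eq0; last first.
  by move=> i _; rewrite -expr2 sqr_ge0.
move=> /allP x0; apply/rowP => i; rewrite mxE.
by have := x0 i (mem_index_enum _); rewrite /= mulf_eq0 orbb => /eqP.
Qed.

Lemma dotv_gt0 x : (0 < dotv x x) = (x != 0).
Proof. by rewrite lt0r dotv_eq0 dotv_ge0 andbT. Qed.

Lemma dotv_span (s : seq 'rV[R]_d) y x : {in s, forall z, dotv y z = 0} ->
  x \in span s -> dotv y x = 0.
Proof.
move=> ys; rewrite -[s]in_tupleE => /coord_span ->.
rewrite /dotv; under eq_bigr do rewrite summxE big_distrr.
rewrite exchange_big big1//= => i _.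
under eq_bigr do rewrite mxE mulrCA.
rewrite -mulr_sumr -/(dotv y _) ys ?mulr0//.
by rewrite mem_nth.
Qed.

(** Subtracting from [z] its projection to [U] along a complement gives a linear map that kills [U]
    but not [x]. Some coordinate [j] of it is nonzero at [x], and [y] represents that coordinate. *)
Lemma dotv_separate (U : {vspace 'rV[R]_d}) x : x \notin U ->
  exists y, {in U, forall z, dotv y z = 0} /\ dotv y x != 0.
Proof.
move=> xU; pose f z := z - projv U z.
have [j fxj] : exists j, f x 0 j != 0.
  apply/existsP; rewrite -negb_forall; apply: contra xU => /forallP fx0.
  have /subr0_eq -> : f x = 0 by apply/rowP => j; rewrite [RHS]mxE; apply/eqP.
  exact: memv_proj.
pose y : 'rV[R]_d := \row_i f (delta_mx 0 i) 0 j.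
have yE z : dotv y z = f z 0 j.
  rewrite {2}(row_sum_delta z) /f linear_sum/= -sumrB summxE.
  apply: eq_bigr => i _.
  by rewrite linearZ/= -scalerBr [RHS]mxE [y _ _]mxE mulrC.
exists y; split=> [z zU|]; last by rewrite yE.
by rewrite yE /f projv_id// subrr mxE.
Qed.

End dot_product.

Section finite_sequences.
Context {R : realType} {T : eqType}.
Implicit Types (s : seq T) (f g : T -> R).

Lemma seq_argmin s f x0 : x0 \in s ->
  exists2 x, x \in s & {in s, forall y, f x <= f y}.
Proof.
elim: s x0 => // x s IH x0 _; case: s IH => [_|y s IH].
  by exists x => [|y]; rewrite ?mem_seq1// => /eqP ->.
have [z zs zmin] := IH y (mem_head _ _).
have [xz|/ltW zx] := leP (f x) (f z).
  exists x => [|w]; rewrite ?mem_head// in_cons => /predU1P[-> //|ws].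
  exact: le_trans (zmin _ ws).
exists z => [|w]; first by rewrite in_cons zs orbT.
by rewrite in_cons => /predU1P[-> //|]; exact: zmin.
Qed.

(** Serves for perturbations: a large multiple of a positive [f] absorbs any correction [g]. *)
Lemma large_scale s f g : {in s, forall x, 0 < f x} ->
  exists2 K, 0 <= K & {in s, forall x, 0 < K * f x + g x}.
Proof.
(* All larger factors are included, so that the bounds for different points combine. *)
move=> f0; suff [K K0 HK] : exists2 K, 0 <= K &
    forall K', K <= K' -> {in s, forall x, 0 < K' * f x + g x}.
  by exists K => //; exact: HK.
elim: s f0 => [|x s IH] f0; first by exists 0.
have [|K K0 HK] := IH; first by move=> y ys; apply: f0; rewrite in_cons ys orbT.
have fx : 0 < f x by apply: f0; rewrite mem_head.
exists (K + (`|g x| + 1) / f x) => [|K' KK' y].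
  by rewrite addr_ge0// divr_ge0 ?(ltW fx)// addr_ge0.
have gf0 : 0 <= (`|g x| + 1) / f x by rewrite divr_ge0 ?(ltW fx)// addr_ge0.
rewrite in_cons => /predU1P[->|ys]; last by apply: HK => //; lra.
have : (`|g x| + 1) / f x <= K' by lra.
rewrite ler_pdivrMr// => h.
by have := lerNnormlW (lexx `|g x|); lra.
Qed.

End finite_sequences.

(** * Polyhedral cones given by generators, and their faces *)

Section polyhedral_cones.
Context {R : realType} {d : nat}.
Implicit Types (X s : seq 'rV[R]_d) (a b x y : 'rV[R]_d).

(* Move along a direction orthogonal to the tight constraints until a new one
   becomes tight. *)
Lemma polyhedron_vertex X (c : 'rV[R]_d -> R) a :
  {in X, forall x, c x <= dotv a x} ->
  exists b, {in X, forall x, c x <= dotv b x} /\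
    {in X, forall x, x \in span [seq x <- X | dotv b x == c x]}.
Proof.
have [n] := ubnP (d - \dim (span [seq x <- X | dotv a x == c x])).
elim: n a => // n IH a dn aP; set T := [seq x <- X | _] in dn.
have [XT|] := boolP (all [in span T] X); first by exists a; split=> //; exact/allP.
move=> /allPn[x0 x0X /dotv_separate[y0 [y0T y0x0]]].
have [y [yT yx0]] : exists y, {in span T, forall z, dotv y z = 0} /\ dotv y x0 < 0.
  have [|y0x0'] := ltP (dotv y0 x0) 0; first by exists y0.
  exists (- y0); split=> [z zT|]; first by rewrite dotvNl y0T ?oppr0.
  by rewrite dotvNl oppr_lt0 lt_neqAle eq_sym y0x0.
(* Time at which the constraint at [x] becomes tight on the ray from [a] along [y]; stopping at the
   smallest one keeps all constraints valid. *)
pose g x := (dotv a x - c x) / - dotv y x.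
have x0Y : x0 \in [seq x <- X | dotv y x < 0] by rewrite mem_filter yx0.
have [x1 + gmin] := seq_argmin g x0Y; rewrite mem_filter => /andP[yx1 x1X].
have g0 : 0 <= g x1.
  by rewrite divr_ge0 ?oppr_ge0 ?(ltW yx1)// subr_ge0 aP.
have bP : {in X, forall x, c x <= dotv (a + g x1 *: y) x}.
  move=> x xX; rewrite dotvDl dotvZl; have ax := aP _ xX.
  have [yx|yx] := leP 0 (dotv y x); first by have := mulr_ge0 g0 yx; lra.
  have : g x1 <= g x by apply: gmin; rewrite mem_filter yx.
  by rewrite {2}/g ler_pdivlMr ?oppr_gt0//; lra.
apply: (IH (a + g x1 *: y)) => //; set T' := [seq x <- X | _].
have TT' : (span T <= span T')%VS.
  apply/span_subvP => x xT; have := xT; rewrite mem_filter => /andP[ax xX].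
  apply: memv_span; rewrite mem_filter xX andbT dotvDl dotvZl.
  by rewrite yT ?mulr0 ?addr0//; exact: memv_span.
have x1T' : x1 \in span T'.
  apply: memv_span; rewrite mem_filter x1X andbT dotvDl dotvZl /g.
  by apply/eqP; field; rewrite lt_eqF.
have : (\dim (span T) < \dim (span T'))%N.
  rewrite ltn_neqAle dimvS// andbT; apply: contraTneq yx1 => TT'E.
  rewrite yT ?ltxx//; suff -> : span T = span T' by [].
  by apply/eqP; rewrite eqEdim TT' TT'E /=.
have : (\dim (span T') <= d)%N.
  by apply: leq_trans (dimvS (subvf _)) _; rewrite dimvf dim_matrix ?mul1n ?mul1r.
move: dn; lia.
Qed.

Definition zeros a X := [seq x <- X | dotv a x == 0].

(** With [c] the indicator of [x1], a vertex [y] of the polyhedron [dotv y x >= c x] on the zeros of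
    [a] is positive at [x1]. Its tight constraints span, so its zeros together with [x1] span all
    zeros of [a]: exactly one dimension is lost. For large [K], [K *: a + y] has just these zeros in
    [X]. *)
Lemma face_avoiding X a0 a x1 :
  {in X, forall x, 0 < dotv a0 x} -> {in X, forall x, 0 <= dotv a x} ->
  x1 \in zeros a X ->
  exists b, [/\ {in X, forall x, 0 <= dotv b x}, {subset zeros b X <= zeros a X},
    x1 \notin zeros b X & (\dim (span (zeros b X))).+1 = \dim (span (zeros a X))].
Proof.
move=> a0P aP x1Z; have := x1Z; rewrite mem_filter => /andP[ax1 x1X].
set Z := zeros a X; pose c x : R := (x == x1)%:R.
have a0x1 := a0P _ x1X.
have [|y [yP yT]] := @polyhedron_vertex Z c ((dotv a0 x1)^-1 *: a0).
  move=> x; rewrite mem_filter => /andP[_ xX]; rewrite dotvZl /c.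
  have [->|_] := eqVneq; first by rewrite mulVf ?gt_eqF.
  by rewrite mulr_ge0 ?invr_ge0 ?(ltW a0x1)// ltW// a0P.
set T := [seq x <- Z | _] in yT.
have yx1 : 0 < dotv y x1.
  by apply: lt_le_trans (yP _ x1Z); rewrite /c eqxx.
have [|K K0 HK] := @large_scale _ _ [seq x <- X | 0 < dotv a x] (dotv a) (dotv y).
  by move=> x; rewrite mem_filter => /andP[].
have cge0 x : 0 <= c x by rewrite /c.
have yZ x : x \in Z -> 0 <= dotv y x by move=> /yP; exact: le_trans.
pose b := K *: a + y.
have bE x : x \in X -> (0 <= dotv b x) /\
    ((dotv b x == 0) = (dotv a x == 0) && (dotv y x == 0)).
  move=> xX; rewrite dotvDl dotvZl.
  have := aP _ xX; rewrite le_eqVlt => /predU1P[ax|ax].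
    rewrite -ax mulr0 add0r eqxx; split=> //; apply: yZ.
    by rewrite mem_filter -ax eqxx.
  have {}HK := HK x; rewrite mem_filter ax xX in HK.
  have bx := HK isT; split; first exact: ltW.
  by rewrite gt_eqF// gt_eqF.
have bZE : zeros b X = zeros y Z.
  rewrite /Z /zeros -filter_predI; apply: eq_in_filter => x /bE[_ ->].
  by rewrite /= andbC.
have x1Z' : x1 \notin span (zeros y Z).
  apply/negP => /dotv_span => /(_ y) yx10.
  move: yx1; rewrite yx10 ?ltxx// => x.
  by rewrite mem_filter => /andP[/eqP].
have sub : {subset zeros y Z <= Z} by move=> x; rewrite mem_filter => /andP[].
exists b; split.
- by move=> x /bE[].
- by rewrite bZE.
- by rewrite bZE; apply: contra x1Z' => /memv_span.
rewrite bZE; apply/eqP; rewrite eqn_leq; apply/andP; split.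
  have ZZ : (span (zeros y Z) <= span Z)%VS by apply: sub_span.
  rewrite ltn_neqAle dimvS// andbT; apply: contraNneq x1Z' => ZE.
  suff -> : span (zeros y Z) = span Z by exact: memv_span.
  by apply/eqP; rewrite eqEdim ZZ ZE /=.
have ZT : (span Z <= <[x1]> + span (zeros y Z))%VS.
  apply: subv_trans (_ : span T <= _)%VS; first by apply/span_subvP.
  rewrite -span_cons; apply: sub_span => x.
  rewrite mem_filter in_cons => /andP[/eqP yx xZ].
  have [//|xx1 /=] := eqVneq x x1.
  by rewrite mem_filter xZ andbT yx /c (negbTE xx1).
apply: leq_trans (dimvS ZT) _; apply: leq_trans (dimv_add_leqif _ _) _.
by rewrite dim_vline; case: (x1 != 0).
Qed.

Lemma face_of_dim X a0 a k :
  {in X, forall x, 0 < dotv a0 x} -> {in X, forall x, 0 <= dotv a x} ->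
  (k <= \dim (span (zeros a X)))%N ->
  exists b, [/\ {in X, forall x, 0 <= dotv b x}, {subset zeros b X <= zeros a X}
    & \dim (span (zeros b X)) = k].
Proof.
move=> a0P; have [n] := ubnP (\dim (span (zeros a X)) - k).
elim: n a => // n IH a kn aP; rewrite leq_eqVlt => /predU1P[->|ka].
  by exists a; split.
have [x xZ] : exists x, x \in zeros a X.
  case: (zeros a X) ka => [|x s]; last by exists x; rewrite mem_head.
  by rewrite span_nil dimv0.
have [b [bP bsub _ bdim]] := face_avoiding a0P aP xZ.
have [||b' [b'P b'sub b'dim]] := IH b _ bP; [lia|lia|].
by exists b'; split=> // z /b'sub/bsub.
Qed.

(** A generator [x] of a first k-face is avoided by a face of one dimension less than that of [a];
    this still has dimension at least [k] and contains a second k-face. *)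
Lemma two_faces_of_dim X a0 a k :
  {in X, forall x, 0 < dotv a0 x} -> {in X, forall x, 0 <= dotv a x} ->
  (0 < k < \dim (span (zeros a X)))%N ->
  exists b1 b2 x, [/\ {in X, forall x, 0 <= dotv b1 x} /\
      {in X, forall x, 0 <= dotv b2 x},
    {subset zeros b1 X <= zeros a X} /\ {subset zeros b2 X <= zeros a X},
    \dim (span (zeros b1 X)) = k /\ \dim (span (zeros b2 X)) = k &
    x \in zeros b1 X /\ x \notin zeros b2 X].
Proof.
move=> a0P aP /andP[k0 ka].
have [b1 [b1P b1s b1d]] := face_of_dim a0P aP (ltnW ka).
have [x xZ] : exists x, x \in zeros b1 X.
  case: (zeros b1 X) b1d k0 => [|x s]; last by exists x; rewrite mem_head.
  by rewrite span_nil dimv0 => <-.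
have [b [bP bs xb bd]] := face_avoiding a0P aP (b1s _ xZ).
have [|b2 [b2P b2s b2d]] := @face_of_dim X a0 b k a0P bP; first by lia.
exists b1, b2, x; split=> //; split=> //.
- by move=> z /b2s/bs.
- by apply: contra xb => /b2s.
Qed.

(* Take a vertex of {a | a.x >= max(0, - l.x) for all x in X}: a constraint
   which is tight there is a zero of a if l.x > 0 and a zero of a + l if
   l.x < 0. *)
Lemma complementary_faces X a0 l :
  {in X, forall x, 0 < dotv a0 x} -> {in X, forall x, dotv l x != 0} ->
  exists a b, [/\ {in X, forall x, 0 <= dotv a x} /\ {in X, forall x, 0 <= dotv b x},
    {in zeros a X, forall x, 0 < dotv l x}, {in zeros b X, forall x, dotv l x < 0} &
    (\dim (span X) <= \dim (span (zeros a X)) + \dim (span (zeros b X)))%N].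
Proof.
move=> a0P l0; pose c x := Num.max 0 (- dotv l x).
have [K K0 HK] := large_scale (dotv l) a0P.
have [|a [aP aT]] := @polyhedron_vertex X c (K *: a0).
  move=> x xX; rewrite dotvZl ge_max mulr_ge0//=; last exact/ltW/a0P.
  by have := HK _ xX; lra.
have aP' x : x \in X -> 0 <= dotv a x /\ 0 <= dotv (a + l) x.
  by move=> /aP; rewrite ge_max dotvDl => /andP[]; split=> //; lra.
exists a, (a + l); split.
- by split=> x /aP'[].
- move=> x; rewrite mem_filter => /andP[/eqP ax xX].
  by have [_] := aP' _ xX; rewrite dotvDl ax add0r lt0r l0.
- move=> x; rewrite mem_filter dotvDl => /andP[/eqP ax xX].
  by have [] := aP' _ xX; have := l0 _ xX; case: ltgtP ax => //; lra.
apply: leq_trans (dimv_add_leqif _ _); apply/dimvS.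
apply: subv_trans (_ : span [seq x <- X | dotv a x == c x] <= _)%VS.
  by apply/span_subvP.
rewrite -span_cat; apply: sub_span => x.
rewrite mem_filter mem_cat !mem_filter => /andP[/eqP ax xX]; rewrite xX !andbT.
rewrite dotvDl ax /c; case: ltP => _; first by rewrite addNr eqxx orbT.
by rewrite eqxx.
Qed.

(** If [l] vanishes at the new vector [x], a large multiple of [l] plus [x] is nonzero at [x] and
    remains nonzero on the rest. *)
Lemma generic_functional X : 0 \notin X ->
  exists l, {in X, forall x, dotv l x != 0}.
Proof.
elim: X => [|x X IH]; first by exists 0.
rewrite in_cons negb_or eq_sym => /andP[x0 /IH[l lP]].
have [lx|lx] := eqVneq (dotv l x) 0; last first.
  by exists l => z; rewrite in_cons => /predU1P[->|/lP].
have [|K K0 HK] := @large_scale _ _ X (fun z => `|dotv l z|) (fun z => - `|dotv x z|).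
  by move=> z /lP; rewrite normr_gt0.
exists (K *: l + x) => z; rewrite in_cons dotvDl dotvZl => /predU1P[->|zX].
  by rewrite lx mulr0 add0r gt_eqF// dotv_gt0.
have := HK _ zX; rewrite -{1}(ger0_norm K0) -normrM => h.
apply/negP => /eqP/addr0_eq E; move: h.
by rewrite -E normrN subrr ltxx.
Qed.

End polyhedral_cones.

(** * Faces of a convex hull at a generating point *)

Section convex_hulls.
Context {R : realType} {d : nat}.
Implicit Types (A : seq 'rV[R]_d) (S B : set 'rV[R]_d) (a b l u v x y : 'rV[R]_d).

Lemma convex_setP S :
  (forall x y (t : R), 0 <= t -> t <= 1 -> S x -> S y -> S (t *: x + (1 - t) *: y)) <->
  convex_set S.
Proof.
split=> [cS x y t /set_mem Sx /set_mem Sy|cS x y t t0 t1 Sx Sy].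
  by apply/mem_set; exact: cS.
have ti : Itv.spec (@Itv.num_sem R) (Itv.Real `[0%Z, 1%Z]) t.
  by rewrite /= /Itv.num_sem /= num_real /= in_itv /= t0 t1.
by have := cS x y (Itv.mk ti); rewrite !inE; exact.
Qed.

Lemma conv_hull_ind S B :
  (forall x y (t : R), 0 <= t -> t <= 1 -> S x -> S y -> S (t *: x + (1 - t) *: y)) ->
  B `<=` S -> conv_hull B `<=` S.
Proof. by move=> /convex_setP cS BS; exact: smallest_sub. Qed.

Lemma conv_hull_conv B x y (t : R) : 0 <= t -> t <= 1 ->
  conv_hull B x -> conv_hull B y -> conv_hull B (t *: x + (1 - t) *: y).
Proof.
move=> t0 t1 Bx By C [cC BC].
by have /convex_setP := cC; apply => //; [exact: Bx|exact: By].
Qed.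

Lemma conv_hull_dotv_ge B a (c : R) x :
  (forall z, B z -> c <= dotv a z) -> conv_hull B x -> c <= dotv a x.
Proof.
move=> Ba; apply: (@conv_hull_ind (fun x => c <= dotv a x)) => //.
move=> {}x y t t0 t1 cx cy; rewrite dotvDr !dotvZr.
have h1 : t * c <= t * dotv a x by rewrite ler_wpM2l.
have h2 : (1 - t) * c <= (1 - t) * dotv a y by rewrite ler_wpM2l// subr_ge0.
lra.
Qed.

Lemma conv_hull_dotv_le B a (c : R) x :
  (forall z, B z -> dotv a z <= c) -> conv_hull B x -> dotv a x <= c.
Proof.
move=> Ba Bx; rewrite -lerN2 -dotvNl; apply: conv_hull_dotv_ge Bx => z Bz.
by rewrite dotvNl lerN2; exact: Ba.
Qed.

(** The points above level [c] that belong to [F] if they are on it form a convex set: with both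
    weights positive, a combination is on the level only if both points are. *)
Lemma conv_hull_face B a (c : R) x : (forall z, B z -> c <= dotv a z) ->
  conv_hull B x -> dotv a x = c -> conv_hull (B `&` [set z | dotv a z = c]) x.
Proof.
move=> Ba Bx; set F := conv_hull _.
pose S y := c <= dotv a y /\ (dotv a y = c -> F y).
suff [] : S x by [].
apply: (@conv_hull_ind S) Bx => [{}x y t t0 t1 [cx Fx] [cy Fy]|z Bz]; last first.
  by split=> [|E]; [exact: Ba|exact: sub_gen_smallest].
have h1 : 0 <= t * (dotv a x - c) by rewrite mulr_ge0// subr_ge0.
have h2 : 0 <= (1 - t) * (dotv a y - c) by rewrite mulr_ge0// subr_ge0.
rewrite /S dotvDr !dotvZr; split=> [|E]; first by lra.
have /eqP : t * (dotv a x - c) = 0 by lra.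
have /eqP : (1 - t) * (dotv a y - c) = 0 by lra.
rewrite !mulf_eq0 !subr_eq0; have [t1E _ _|_ /= /eqP ay] := eqVneq 1 t.
  rewrite -{}t1E in E *; rewrite subrr scale0r addr0 scale1r; apply: Fx.
  by move: E; rewrite subrr mul0r mul1r addr0.
have [-> _|_ /= /eqP ax] := eqVneq t 0.
  by rewrite scale0r add0r subr0 scale1r; exact: Fy.
by apply: conv_hull_conv => //; [exact: Fx|exact: Fy].
Qed.

Lemma affine_span B v (s : seq 'rV[R]_d) u : is_affine B -> B v ->
  {in s, forall z, B (v + z)} -> u \in span s -> B (v + u).
Proof.
move=> aB Bv; have BZ t z : B (v + z) -> B (v + t *: z).
  move=> /(aB _ _ t Bv); congr B.
  by rewrite scalerDr addrA -scalerDl subrK scale1r.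
(* The midpoint of [v + 2 y] and [v + 2 z] is [v + (y + z)]. *)
have BD y z : B (v + y) -> B (v + z) -> B (v + (y + z)).
  move=> /(BZ 2) By /(BZ 2) Bz; have := aB _ _ 2^-1 By Bz; congr B.
  have h : 1 - 2^-1 = 2^-1 :> R by lra.
  rewrite h !scalerDr !scalerA mulVf// !scale1r addrACA -scalerDl.
  by rewrite (_ : 2^-1 + 2^-1 = 1) ?scale1r//; lra.
elim: s u => [|x s IH] u Bs.
  by rewrite span_nil memv0 => /eqP ->; rewrite addr0.
rewrite span_cons => /memv_addP[_ /vlineP[t ->] [w ws ->]].
apply: BD; first by apply/BZ/Bs; rewrite mem_head.
by apply: IH ws => z zs; apply: Bs; rewrite in_cons zs orbT.
Qed.

(** Differences to all other points of the list generate the cone of the hull at [v]; edge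
    directions are not singled out. *)
Definition directions A v := [seq x - v | x <- A & x != v].

Lemma directionsP A v x : x \in A -> x != v -> x - v \in directions A v.
Proof. by move=> xA xv; apply/mapP; exists x => //; rewrite mem_filter xv. Qed.

Lemma directions_ge A v a x : {in directions A v, forall z, 0 <= dotv a z} ->
  x \in A -> dotv a v <= dotv a x.
Proof.
move=> aP xA; have [->//|xv] := eqVneq x v.
by rewrite -subr_ge0 -dotvBr; apply/aP/directionsP.
Qed.

Section face_at.
Variables (A : seq 'rV[R]_d) (v a : 'rV[R]_d).
Hypothesis vA : v \in A.
Hypothesis aP : {in directions A v, forall x, 0 <= dotv a x}.

Let P := conv_hull [set` A].
Let F := P `&` [set x | dotv a x = dotv a v].
Let Z := zeros a (directions A v).

(** By [conv_hull_face] the face is the hull of the points of [A] on it, and their differences from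
    [v] are [0] and the elements of [Z]; so its affine hull is [v] plus the span of [Z]. *)
Lemma face_at_dim : faces (\dim (span Z)) P F.
Proof.
have PA z : z \in A -> P z by move=> ?; exact: sub_gen_smallest.
split.
  exists (- a), (- dotv a v); split=> [x Px|].
    rewrite dotvNl lerN2; apply: conv_hull_dotv_ge Px => z.
    exact: directions_ge.
  by apply/seteqP; split=> x [Px] /=; rewrite dotvNl; [move=> ->|move=> /oppr_inj].
exists v, (span Z); split=> //; apply/seteqP; split.
  apply: smallest_sub => [x y t [u uZ <-] [w wZ <-]|x [Px ax]].
    exists ((1 - t) *: u + t *: w); first by apply: memvD; apply: memvZ.
    by rewrite !scalerDr addrACA -scalerDl subrK scale1r.
  have : conv_hull ([set` A] `&` [set z | dotv a z = dotv a v]) x.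
    by apply: conv_hull_face => // z; exact: directions_ge.
  apply: conv_hull_ind => [y z t t0 t1 [u uZ <-] [w wZ <-]|z [/= zA az]].
    exists (t *: u + (1 - t) *: w); first by apply: memvD; apply: memvZ.
    by rewrite !scalerDr addrACA -scalerDl (addrC t) subrK scale1r.
  exists (z - v); last by rewrite addrC subrK.
  have [->|zv] := eqVneq z v; first by rewrite /= subrr mem0v.
  by apply: memv_span; rewrite mem_filter dotvBr az subrr eqxx directionsP.
move=> _ [u uZ <-] B [aB FB]; apply: affine_span uZ => //.
  by apply: FB; split=> //; exact: PA.
move=> z; rewrite mem_filter => /andP[/eqP az /mapP[x]].
rewrite mem_filter => /andP[_ xA] zE; apply: FB; rewrite zE addrC subrK.
split; first exact: PA.
by apply/eqP; rewrite -subr_eq0 -dotvBr -zE az.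
Qed.

(** Generators of the face other than [v] differ from [v] by elements of [Z], and being [v] or
    strictly above [v] passes to convex combinations. *)
Lemma face_at_low l x : {in Z, forall z, 0 < dotv l z} -> F x -> x != v ->
  dotv l v < dotv l x.
Proof.
move=> lP [Px ax].
have : conv_hull ([set` A] `&` [set z | dotv a z = dotv a v]) x.
  by apply: conv_hull_face => // z; exact: directions_ge.
move=> Fx; suff : x = v \/ dotv l v < dotv l x.
  by case=> [->|//]; rewrite eqxx.
move: Fx; apply: (@conv_hull_ind (fun x => x = v \/ dotv l v < dotv l x)).
  move=> y z t t0 t1 yv zv.
  have cvx (w : 'rV[R]_d) : t *: w + (1 - t) *: w = w.
    by rewrite -scalerDl addrC subrK scale1r.
  have [->|t0'] := eqVneq t 0; first by rewrite scale0r add0r subr0 scale1r.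
  have [->|t1'] := eqVneq t 1; first by rewrite subrr scale0r addr0 scale1r.
  have tgt0 : 0 < t by rewrite lt0r t0' t0.
  have tlt1 : 0 < 1 - t by rewrite subr_gt0 lt_neqAle t1' t1.
  rewrite dotvDr !dotvZr.
  case: yv zv => [->|yv] [->|zv]; first by left; rewrite cvx.
  - by right; have := mulr_gt0 tlt1 (_ : 0 < dotv l z - dotv l v); lra.
  - by right; have := mulr_gt0 tgt0 (_ : 0 < dotv l y - dotv l v); lra.
  - right; have := mulr_gt0 tlt1 (_ : 0 < dotv l z - dotv l v).
    by have := mulr_gt0 tgt0 (_ : 0 < dotv l y - dotv l v); lra.
move=> z [/= zA az]; have [->|zv] := eqVneq z v; [by left|right].
rewrite -subr_gt0 -dotvBr; apply: lP.
by rewrite mem_filter dotvBr az subrr eqxx directionsP.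
Qed.

(** Recovers [Z] from the face, so that different zero sets give different faces. *)
Lemma face_at_mem x : x \in directions A v -> F (v + x) <-> x \in Z.
Proof.
move=> /[dup] xD /mapP[y]; rewrite !mem_filter => /andP[_ yA] xE.
rewrite xD andbT.
have vxA : v + x \in A by rewrite xE addrC subrK.
split=> [[_ /= /eqP]|/eqP ax].
  by rewrite dotvDr addrC -subr_eq0 addrK.
by split; [exact: sub_gen_smallest|rewrite /= dotvDr ax addr0].
Qed.

End face_at.
End convex_hulls.

(** * Exposed points and the number of k-faces *)

Section vertices.
Context {R : realType} {d : nat}.
Implicit Types (A : seq 'rV[R]_d) (F : set 'rV[R]_d) (a l u v x y : 'rV[R]_d).

Definition exposed A v := exists a, {in directions A v, forall x, 0 < dotv a x}.

(** [undup] makes the length of the list the number of exposed points. *)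
Definition vertices A := [seq v <- undup A | `[< exposed A v >]].

Lemma verticesP A v : v \in vertices A -> v \in A /\ exposed A v.
Proof. by rewrite mem_filter mem_undup => /andP[/asboolP]. Qed.

Lemma generic_differences A :
  exists l, {in A &, forall x y, x != y -> dotv l x != dotv l y}.
Proof.
pose X := [seq z <- [seq x - y | x <- A, y <- A] | z != 0].
have [|l lP] := @generic_functional R d X.
  by rewrite mem_filter eqxx.
exists l => x y xA yA xy; rewrite -subr_eq0 -dotvBr; apply: lP.
by rewrite mem_filter subr_eq0 xy; apply/allpairsP; exists (x, y).
Qed.

(** Among the points of [A] that maximize [u], a generic [z] has a unique maximum [v]. For large [K]
    the functional [K *: u + z] has its unique maximum over [A] at [v], so [v] is exposed. *)
Lemma vertices_max A u x : conv_hull [set` A] x ->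
  exists2 v, v \in vertices A & dotv u x <= dotv u v.
Proof.
move=> Px; have [z zP] := generic_differences A.
have [x0 x0A] : exists x0, x0 \in A.
  case: A Px {zP} => [|x0 A _]; last by exists x0; rewrite mem_head.
  by move/(@conv_hull_ind _ _ set0); case.
have [v1 v1A v1max] := seq_argmin (fun x => - dotv u x) x0A.
have v1A' : v1 \in [seq x <- A | dotv u x == dotv u v1] by rewrite mem_filter eqxx.
have [v + vmax] := seq_argmin (fun x => - dotv z x) v1A'.
rewrite mem_filter => /andP[/eqP uv vA].
have umax y : y \in A -> dotv u y <= dotv u v.
  by move=> /v1max; rewrite lerN2 uv.
exists v; last by apply: conv_hull_dotv_le Px.
rewrite mem_filter mem_undup vA andbT; apply/asboolP.
have [|K K0 HK] := @large_scale _ _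
    [seq x <- directions A v | dotv u x < 0] (dotv (- u)) (dotv (- z)).
  by move=> y; rewrite mem_filter dotvNl oppr_gt0 => /andP[].
exists (K *: (- u) - z) => w wD; rewrite dotvDl dotvZl.
have [uw|uw] := ltP (dotv u w) 0; first by apply: HK; rewrite mem_filter uw.
move: wD => /mapP[y]; rewrite mem_filter => /andP[yv yA] wE.
have uw0 : dotv u w = 0.
  by apply/eqP; rewrite eq_le uw andbT wE dotvBr subr_le0 umax.
rewrite dotvNl uw0 oppr0 mulr0 add0r dotvNl oppr_gt0 lt_neqAle.
rewrite wE dotvBr subr_eq0 zP//= subr_le0 -lerN2; apply: vmax.
by rewrite mem_filter yA andbT -uv -subr_eq0 -dotvBr -wE uw0.
Qed.

Definition lowest l v F := F v /\ forall x, F x -> x != v -> dotv l v < dotv l x.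

(** Each of two such points would lie strictly below the other. In the count, a face and a sign thus
    determine the vertex. *)
Lemma lowest_inj l v w F : lowest l v F -> lowest l w F -> v = w.
Proof.
move=> [Fv vP] [Fw wP]; have [//|vw] := eqVneq v w.
have wv : w != v by rewrite eq_sym.
by have := lt_trans (wP _ Fv vw) (vP _ Fw wv); rewrite ltxx.
Qed.

Definition signed (s : bool) l := if s then - l else l.

(* As [k <= d/2], complementary faces of the cone at [v] provide either a k-face
   on each side of the level set of [l], or two distinct k-faces on one side. *)
Lemma vertex_two_faces A v l k : v \in A -> exposed A v ->
  {in A &, forall x y, x != y -> dotv l x != dotv l y} ->
  \dim (span (directions A v)) = d -> (k <= d./2)%N ->
  exists (F : bool -> set 'rV[R]_d) (s : bool -> bool),
    [/\ forall i, faces k (conv_hull [set` A]) (F i),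
        forall i, lowest (signed (s i) l) v (F i) &
        (F true, s true) <> (F false, s false)].
Proof.
move=> vA [a0 a0P] lP dimA kd; set P := conv_hull _; set X := directions A v in a0P dimA.
have l0 : {in X, forall x, dotv l x != 0}.
  move=> _ /mapP[x + ->]; rewrite mem_filter => /andP[xv xA].
  by rewrite dotvBr subr_eq0 lP.
pose face a := P `&` [set x | dotv a x = dotv a v].
have faceP a m s : {in X, forall x, 0 <= dotv a x} ->
    {in zeros a X, forall x, 0 < dotv (signed s l) x} ->
    \dim (span (zeros a X)) = m -> faces m P (face a) /\ lowest (signed s l) v (face a).
  move=> aP alow <-; split; first exact: face_at_dim.
  split=> [|x Fx xv]; last exact: face_at_low Fx xv.
  by split=> //; exact: sub_gen_smallest.
have two a s : {in X, forall x, 0 <= dotv a x} ->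
    {in zeros a X, forall x, 0 < dotv (signed s l) x} ->
    (0 < k < \dim (span (zeros a X)))%N ->
    exists (F : bool -> set 'rV[R]_d) (s : bool -> bool),
    [/\ forall i, faces k P (F i), forall i, lowest (signed (s i) l) v (F i) &
        (F true, s true) <> (F false, s false)].
  move=> aP alow ka.
  have [b1 [b2 [x [[b1P b2P] [b1a b2a] [b1k b2k] [x1 x2]]]]] :=
    two_faces_of_dim a0P aP ka.
  have [F1 L1] := faceP _ _ s b1P (sub_in1 b1a alow) b1k.
  have [F2 L2] := faceP _ _ s b2P (sub_in1 b2a alow) b2k.
  exists (fun i => face (if i then b1 else b2)), (fun=> s).
  split=> [[]|[]|[]]//= E.
  have xX : x \in X by move: x1; rewrite mem_filter => /andP[].
  have : face b1 (v + x) by apply/face_at_mem.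
  rewrite E => /face_at_mem; rewrite (negbTE x2).
  by move=> /(_ xX).
have [a [b [[aP bP] ap bn]]] := complementary_faces a0P l0.
rewrite dimA => dab.
have ap' : {in zeros a X, forall x, 0 < dotv (signed false l) x} by [].
have bn' : {in zeros b X, forall x, 0 < dotv (signed true l) x}.
  by move=> x /bn; rewrite dotvNl oppr_gt0.
have kdd : (k + k <= d)%N by have := odd_double_half d; rewrite -addnn; lia.
(* In this case [0 < k], and as the two dimensions add up to at least [d >= 2 k], the zeros of [b]
   span more than [k] dimensions. *)
have [ak|ka] := ltnP (\dim (span (zeros a X))) k.
  by apply: (two _ _ bP bn'); move: ak dab kdd; clear; lia.
have [bk|kb] := ltnP (\dim (span (zeros b X))) k.
  by apply: (two _ _ aP ap'); move: bk dab kdd; clear; lia.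
have [a' [a'P a'a a'k]] := face_of_dim a0P aP ka.
have [b' [b'P b'b b'k]] := face_of_dim a0P bP kb.
have [F1 L1] := faceP _ _ _ a'P (sub_in1 a'a ap') a'k.
have [F2 L2] := faceP _ _ _ b'P (sub_in1 b'b bn') b'k.
(* For [k = 0] both faces are the point [v]; the signs still make the two pairs distinct. *)
by exists (fun i => face (if i then b' else a')), id; split=> [[]|[]|].
Qed.

(** Otherwise some nonzero [y] is orthogonal to all directions, hence constant on the hull, although
    its values at [0] and at [e / enorm y *: y] differ. *)
Lemma ball_hull_directions A v e : 0 < e ->
  (forall u, enorm u <= e -> conv_hull [set` A] u) ->
  \dim (span (directions A v)) = d.
Proof.
move=> e0 eP; suff -> : span (directions A v) = fullv.
  by rewrite dimvf dim_matrix ?mul1n ?mul1r.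
apply/eqP; rewrite eqEsubv subvf /=; apply/subvP => x _.
apply: contraT => /dotv_separate[y [yD yx]].
have y0 : y != 0 by apply: contraNneq yx => ->; rewrite dotv0l.
have yA z : z \in A -> dotv y z = dotv y v.
  move=> zA; have [->//|zv] := eqVneq z v.
  by apply: subr0_eq; rewrite -dotvBr yD//; exact/memv_span/directionsP.
have yP z : conv_hull [set` A] z -> dotv y z = dotv y v.
  move=> Pz; apply/eqP; rewrite eq_le; apply/andP; split.
    by apply: conv_hull_dotv_le Pz => w /yA ->.
  by apply: conv_hull_dotv_ge Pz => w /yA ->.
have ny : 0 < enorm y by rewrite sqrtr_gt0 dotv_gt0.
have := yP (e / enorm y *: y); rewrite -(yP 0) ?dotv0r; last first.
  by apply: eP; rewrite /enorm dotv0r sqrtr0 ltW.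
rewrite dotvZr => /(_ _) /eqP; rewrite !mulf_eq0 invr_eq0 dotv_eq0.
rewrite (negbTE y0) (gt_eqF e0) (gt_eqF ny) /=; apply.
apply: eP; rewrite /enorm dotvZl dotvZr mulrA -expr2 sqrtrM ?sqr_ge0//.
rewrite sqrtr_sqr ger0_norm ?divr_ge0 ?(ltW e0) ?(ltW ny)//.
by rewrite divfK ?gt_eqF.
Qed.

(** Each vertex owns two pairs of a k-face and a sign, and no pair has two owners; so twice the
    number of vertices is at most [2 * M]. *)
Lemma size_vertices_le A e k M : 0 < e ->
  (forall u, enorm u <= e -> conv_hull [set` A] u) -> (k <= d./2)%N ->
  (faces k (conv_hull [set` A]) #<= `I_M)%card -> (size (vertices A) <= M)%N.
Proof.
move=> e0 eP kd /pcard_leP/injfunPex[g gM gI]; have [l lP] := generic_differences A.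
set V := vertices A; set P := conv_hull _ in eP gM gI.
have two (i : 'I_(size V)) : exists Fs : bool -> set 'rV[R]_d * bool,
    [/\ forall j, faces k P (Fs j).1, forall j, lowest (signed (Fs j).2 l) V`_i (Fs j).1
      & Fs true <> Fs false].
  have /verticesP[vA vE] := mem_nth 0 (ltn_ord i).
  have [F [s [FP Fl Fs]]] := vertex_two_faces vA vE lP (ball_hull_directions _ e0 eP) kd.
  by exists (fun j => (F j, s j)).
pose Fs i := projT1 (cid (two i)).
have FsP i : [/\ forall j, faces k P (Fs i j).1,
    forall j, lowest (signed (Fs i j).2 l) V`_i (Fs i j).1 & Fs i true <> Fs i false].
  by rewrite /Fs; case: cid.
have gM' i j : (g (Fs i j).1 < M)%N by have [/(_ j) + _ _] := FsP i; exact: gM.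
pose h (p : 'I_(size V) * bool) : 'I_M * bool :=
  (Ordinal (gM' p.1 p.2), (Fs p.1 p.2).2).
have hI : injective h.
  move=> [i j] [i' j'] [/gI]; rewrite !inE /=.
  have [Fk Fl Fneq] := FsP i; have [Fk' Fl' _] := FsP i'.
  move=> /(_ (Fk j) (Fk' j')) FE sE.
  have ii' : i = i'.
    have := Fl j; rewrite FE sE => /lowest_inj/(_ (Fl' j')) /eqP.
    by rewrite nth_uniq ?filter_uniq ?undup_uniq// => /eqP/val_inj.
  move: FE sE; rewrite -ii' => FE sE.
  have : Fs i j = Fs i j' by rewrite (surjective_pairing (Fs i j)) FE sE -surjective_pairing.
  by case: j {FE sE} => [] //; case: j' => // /esym.
have := leq_card _ hI; rewrite !card_prod !card_ord card_bool.
by rewrite leq_pmul2r.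
Qed.

(** A nonzero [y] orthogonal to all vertices would be at most [0] on the hull by [vertices_max], but
    it is positive somewhere in the ball. The bound later yields [d <= M], which keeps the caps
    small. *)
Lemma size_vertices_ge A e : 0 < e ->
  (forall u, enorm u <= e -> conv_hull [set` A] u) -> (d <= size (vertices A))%N.
Proof.
move=> e0 eP; have : (\dim (span (vertices A)) <= size (vertices A))%N by exact: dim_span.
apply: leq_trans; suff -> : span (vertices A) = fullv.
  by rewrite dimvf dim_matrix ?mul1n ?mul1r.
apply/eqP; rewrite eqEsubv subvf /=; apply/subvP => x _.
apply: contraT => /dotv_separate[y [yD yx]].
have y0 : y != 0 by apply: contraNneq yx => ->; rewrite dotv0l.
have ny : 0 < enorm y by rewrite sqrtr_gt0 dotv_gt0.
have /(vertices_max y)[v vV] : conv_hull [set` A] (e / enorm y *: y).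
  apply: eP; rewrite /enorm dotvZl dotvZr mulrA -expr2 sqrtrM ?sqr_ge0//.
  rewrite sqrtr_sqr ger0_norm ?divr_ge0 ?(ltW e0) ?(ltW ny)//.
  by rewrite divfK ?gt_eqF.
rewrite (yD v) ?memv_span// dotvZr leNgt mulr_gt0 ?dotv_gt0//.
by rewrite divr_gt0.
Qed.

End vertices.

(** * Lebesgue measure on R^n *)

(** Packages the scaled image as a measure, so that uniqueness of Lebesgue measure applies to it. *)
Lemma scaled_image_measure (R : realType) d1 d2 (T1 : measurableType d1)
    (T2 : measurableType d2) (m : {measure set T1 -> \bar R}) (f : T1 -> T2) (c : R) :
  0 <= c -> measurable_fun setT f ->
  exists m' : {measure set T2 -> \bar R}, forall A, m' A = (c%:E * m (f @^-1` A))%E.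
Proof.
move=> c0 mf; pose m1 := measure_function_pushforward__canonical__measure_function_Measure m mf.
by exists (mscale (NngNum c0) m1).
Qed.

Section affine_lebesgue.
Context {R : realType}.
Local Open Scope ereal_scope.

Lemma measurable_affine (a b : R) :
  measurable_fun [set: measurableTypeR R] (fun x => a * x + b : measurableTypeR R)%R.
Proof. by apply: measurable_funD => //; exact: measurable_funM. Qed.

Lemma lebesgue_measure_affine_pos a b (A : set (measurableTypeR R)) : (0 < a)%R ->
  measurable A ->
  lebesgue_measure A = a%:E * lebesgue_measure [set x | A (a * x + b)%R].
Proof.
move=> a0 mA.
have [m mE] := scaled_image_measure (@lebesgue_measure R) (ltW a0) (measurable_affine a b).
rewrite -[RHS](mE A); apply: lebesgue_measure_unique => //= _ [[u v]] _ <-; rewrite mE /=.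
rewrite (_ : _ @^-1` _ = [set` `]((u - b) / a)%R, ((v - b) / a)%R]] :> set R).
  rewrite !lebesgue_measure_itv/= !lte_fin ltr_pM2r ?invr_gt0// ltrD2r.
  case: ifP => _; last by rewrite mule0.
  by rewrite -!EFinD -EFinM; congr EFin; field; rewrite gt_eqF.
apply/seteqP; split=> x /=; rewrite !in_itv/=;
  by rewrite ltr_pdivrMr// ler_pdivlMr// ltrBlDr lerBrDr mulrC.
Qed.

Lemma lebesgue_measure_affine a b (A : set (measurableTypeR R)) : (a != 0)%R ->
  measurable A ->
  lebesgue_measure A = `|a|%:E * lebesgue_measure [set x | A (a * x + b)%R].
Proof.
move=> a0 mA; have [ap|an] := leP 0%R a.
  by rewrite ger0_norm//; apply: lebesgue_measure_affine_pos => //; rewrite lt0r a0.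
rewrite ltr0_norm// -lebesgue_measureN//.
have mN : measurable ((-%R : _ -> measurableTypeR R) @^-1` A).
  by rewrite -[X in measurable X]setTI; exact: oppr_measurable.
rewrite /pushforward (@lebesgue_measure_affine_pos (- a)%R (- b)%R)//; last by rewrite oppr_gt0.
congr (_ * lebesgue_measure _); apply/seteqP; split => x /=;
  by rewrite mulNr opprD !opprK.
Qed.

End affine_lebesgue.

Section measurable_vectors.
Context {R : realType} {d : measure_display} {T : measurableType d} {n : nat}.
Implicit Types f g : T -> 'rV[R]_n.

Lemma measurable_fun_rVP f :
  measurable_fun setT f <-> forall i, measurable_fun setT (fun x => f x 0 i : measurableTypeR R).
Proof.
split=> [mf i|]; last exact: measurable_fun_rV.
by apply: (@measurableT_comp _ _ _ _ _ _ (rV_coord i)) => //; exact: measurable_rV_coord.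
Qed.

Lemma measurable_rVD f g : measurable_fun setT f -> measurable_fun setT g ->
  measurable_fun setT (fun x => f x + g x)%R.
Proof.
move=> /measurable_fun_rVP mf /measurable_fun_rVP mg; apply/measurable_fun_rVP => i.
rewrite (_ : (fun _ => _) = (fun x => f x 0 i + g x 0 i))%R.
  by apply: measurable_funD; [exact: mf|exact: mg].
by apply/funext => x; rewrite mxE.
Qed.

Lemma measurable_rVZ (h : T -> R) f : measurable_fun setT h -> measurable_fun setT f ->
  measurable_fun setT (fun x => h x *: f x)%R.
Proof.
move=> mh /measurable_fun_rVP mf; apply/measurable_fun_rVP => i.
rewrite (_ : (fun _ => _) = (fun x => h x * f x 0 i))%R.
  by apply: measurable_funM => //; exact: mf.
by apply/funext => x; rewrite mxE.
Qed.

Lemma measurable_dotv a f : measurable_fun setT f ->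
  measurable_fun setT (fun x => dotv a (f x)).
Proof.
move=> /measurable_fun_rVP mf; apply: measurable_sum => i.
by apply: measurable_funM => //; exact: mf.
Qed.

End measurable_vectors.

Section lebesgue_rV_theory.
Context {R : realType} {n : nat}.
Local Open Scope ereal_scope.

Let box (A : 'I_n -> set (measurableTypeR R)) := [set x : 'rV[R]_n | forall i, A i (x 0%R i)].

Let measurable_boxes A : (forall i, measurable (A i)) -> measurable (box A).
Proof.
move=> mA; rewrite [X in measurable X](_ : _ = \bigcap_(i in setT) (rV_coord i @^-1` A i)).
  apply: fin_bigcap_measurable => [|i _]; first exact: finite_finset.
  by rewrite -[X in measurable X]setTI; exact: measurable_rV_coord.
by apply/seteqP; split=> x /= h i; [move=> _|]; exact: h.
Qed.

(** Boxes are stable under intersection and generate the sigma-algebra; the cubes with sides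
    [[-k, k]] have finite measure and exhaust the space. *)
Lemma lebesgue_rV_unique (m : {measure set 'rV[R]_n -> \bar R}) :
  (forall A : 'I_n -> set (measurableTypeR R), (forall i, measurable (A i)) ->
    m [set x : 'rV[R]_n | forall i, A i (x 0%R i)] = \prod_i lebesgue_measure (A i)) ->
  forall A, measurable A -> lebesgue_rV n A = m A.
Proof.
move=> mbox; pose G := [set box A | A in [set A : 'I_n -> set (measurableTypeR R) |
  forall i, measurable (A i)]].
pose I k : set (measurableTypeR R) := [set` `[(- k%:R)%R, k%:R%R]].
move=> A mA; have : <<s G >> A.
  move: A mA; apply: smallest_sub; first exact: smallest_sigma_algebra.
  rewrite -bigcup_seq; apply: bigcup_sub => i _ _ [B mB <-].
  apply: sub_sigma_algebra; exists (fun j => if j == i then B else setT).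
    by move=> j; case: eqP.
  rewrite setTI; apply/seteqP; split=> x /=.
    by move=> /(_ i); rewrite eqxx.
  by move=> Bx j; case: eqP => // ->.
apply: (@g_sigma_algebra_measure_unique _ _ _ G _ (fun k => box (fun=> I k))) => {A mA}.
- by move=> _ [A mA <-]; exact: measurable_boxes.
- by move=> k; exists (fun=> I k) => //= i; exact: measurable_itv.
- apply/seteqP; split=> // x _.
  pose k := \max_(i < n) (Num.truncn `|x 0%R i|).+1.
  exists k => // i /=; rewrite /I /= in_itv/= -ler_norml.
  apply: le_trans (_ : (Num.truncn `|x 0%R i|).+1%:R <= _)%R; first exact/ltW/truncnS_gt.
  by rewrite ler_nat /k (bigD1 i)//= leq_maxl.
- move=> _ _ [A mA <-] [B mB <-]; exists (fun i => A i `&` B i).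
    by move=> i; exact: measurableI.
  by apply/seteqP; split=> x /=; [move=> h; split=> i; case: (h i)|move=> [h1 h2] i; split].
- by move=> _ [A mA <-]; rewrite mbox//; exact: lebesgue_rV_box.
- move=> k; rewrite [ltLHS]lebesgue_rV_box; last by move=> i; exact: measurable_itv.
  rewrite (eq_bigr (fun=> (k%:R - - k%:R)%R%:E)).
    by rewrite prodEFin ltry.
  move=> i _; rewrite lebesgue_measure_itv/= lte_fin.
  case: ltP => // k0.
  suff -> : k%:R = 0%R :> R by rewrite oppr0 subr0.
  by apply/eqP; rewrite eq_le ler0n andbT; move: k0; lra.
Qed.

(** The preimage of a box is a box, so uniqueness reduces the claim to dimension one on each
    side. *)
Lemma lebesgue_rV_affine (a : R) (b : 'rV[R]_n) (A : set 'rV[R]_n) :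
  (a != 0)%R -> measurable A ->
  lebesgue_rV n A = (`|a| ^+ n)%:E * lebesgue_rV n [set x | A (a *: x + b)%R].
Proof.
move=> a0 mA.
have mf : measurable_fun [set: 'rV[R]_n] (fun x => a *: x + b)%R.
  by apply: measurable_rVD => //; exact: measurable_rVZ.
have [m mE] := scaled_image_measure (lebesgue_rV n) (exprn_ge0 n (normr_ge0 a)) mf.
rewrite -[RHS](mE A); apply: lebesgue_rV_unique => // {mA}A mA; rewrite mE /=.
rewrite (_ : _ @^-1` _ = box (fun i => [set x | A i (a * x + b 0 i)]))%R.
  rewrite [X in _ * X]lebesgue_rV_box; last first.
    move=> i; rewrite -[X in measurable X]setTI.
    by have /(_ measurableT _ (mA i)) := measurable_affine a (b 0%R i).
  rewrite [RHS](eq_bigr (fun i =>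
    `|a|%:E * lebesgue_measure [set x | A i (a * x + b 0%R i)%R])).
    rewrite big_split/= prodEFin prodr_const card_ord.
    by [].
  by move=> i _; exact: lebesgue_measure_affine.
by apply/seteqP; split=> x /= h i; have := h i; rewrite !mxE.
Qed.


End lebesgue_rV_theory.

Lemma fubini_sections (R : realType) d1 d2 (T1 : measurableType d1) (T2 : measurableType d2)
    (m1 : {sigma_finite_measure set T1 -> \bar R})
    (m2 : {sigma_finite_measure set T2 -> \bar R}) (A : set (T1 * T2)) :
  measurable A ->
  (\int[m1]_x m2 (xsection A x) = \int[m2]_y m1 (ysection A y))%E.
Proof.
move=> mA; have := indic_fubini_tonelli m1 m2 mA.
by rewrite (indic_fubini_tonelli_FE m2 mA) (indic_fubini_tonelli_GE m1 mA).
Qed.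

(** * Invariance under linear isometries *)

Section linear_isometries.
Context {R : realType} {n : nat}.
Implicit Types (A : set 'rV[R]_n) (b : 'rV[R]_n).
Local Open Scope ereal_scope.
Let mu := @lebesgue_rV R n.

Lemma lebesgue_rVD A b : measurable A -> mu [set x | A (x + b)%R] = mu A.
Proof.
move=> mA; rewrite /mu (lebesgue_rV_affine b (oner_neq0 _) mA) normr1 expr1n mul1e.
by congr (lebesgue_rV n _); apply/seteqP; split=> x /=; rewrite scale1r.
Qed.

Lemma lebesgue_rVB A b : measurable A -> mu [set x | A (b - x)%R] = mu A.
Proof.
move=> mA; have N1 : (- 1 != 0 :> R)%R by rewrite oppr_eq0 oner_neq0.
rewrite /mu (lebesgue_rV_affine b N1 mA) normrN1 expr1n mul1e.
by congr (lebesgue_rV n _); apply/seteqP; split=> x /=; rewrite scaleN1r addrC.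
Qed.

Lemma measurable_rV_preim d (T : measurableType d) (f : T -> 'rV[R]_n) A :
  measurable_fun setT f -> measurable A -> measurable [set x | A (f x)].
Proof. by move=> mf mA; rewrite -[X in measurable X]setTI; exact: mf. Qed.

(* The argument for uniqueness of Haar measure, for the image of [mu] by [H]:
   with B the unit ball, both sides of
   [mu B * mu (H @^-1` A) = mu (H @^-1` B) * mu A]
   are the integral of 1_B(x + H y) 1_A(H y) over pairs (x, y). *)
Lemma lebesgue_rV_involutive_isometry (H : 'rV[R]_n -> 'rV[R]_n) A :
  (forall x y, H (x + y) = H x + H y)%R -> involutive H ->
  (forall x, enorm (H x) = enorm x) -> measurable_fun setT H -> measurable A ->
  mu [set x | A (H x)] = mu A.
Proof.
move=> HD HK He mH mA; pose B := @eball R n.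
have mB : measurable B by exact: measurable_eball.
have HN x : H (- x)%R = (- H x)%R.
  have H0 : H 0%R = 0%R by apply: (addrI (H 0%R)); rewrite -HD !addr0.
  by apply: (addrI (H x)); rewrite -HD !subrr.
have HB : [set y | B (H y)] = B.
  by apply/seteqP; split=> y; rewrite /B /eball /= He.
have mHA := measurable_rV_preim mH mA; have mHB := measurable_rV_preim mH mB.
have m1 : measurable_fun setT (fun p : 'rV[R]_n * 'rV[R]_n => H p.2).
  exact: (measurableT_comp mH measurable_snd).
have mD : measurable_fun setT (fun p : 'rV[R]_n * 'rV[R]_n => p.1 + H p.2)%R.
  by apply: measurable_rVD => //; exact: measurable_fst.
have mS : measurable_fun setT (fun p : 'rV[R]_n * 'rV[R]_n => H p.2 - p.1)%R.
  rewrite (_ : (fun _ => _) = (fun p => H p.2 + (-1) *: p.1)%R).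
    by apply: measurable_rVD => //; apply: measurable_rVZ => //; exact: measurable_fst.
  by apply/funext => p; rewrite scaleN1r.
pose S := [set p : 'rV[R]_n * 'rV[R]_n | B (p.1 + H p.2)%R] `&` [set p | A (H p.2)].
pose S' := [set p : 'rV[R]_n * 'rV[R]_n | B (H p.2)] `&` [set p | A (H p.2 - p.1)%R].
have mSet : measurable S by apply: measurableI; exact: measurable_rV_preim.
have mSet' : measurable S' by apply: measurableI; exact: measurable_rV_preim.
have E : \int[mu]_y mu (ysection S y) = \int[mu]_y mu (ysection S' y).
  rewrite -!fubini_sections//; apply: eq_integral => x _.
  (* Shifting [y] by [- H x] replaces [H y] by [H y - x], which turns the section of [S] at [x] into
     that of [S']. *)
  rewrite -(lebesgue_rVD (- H x) (measurable_xsection x mSet)).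
  congr (mu _); apply/seteqP; split=> y; rewrite !xsectionE /S /S' /= HD HN HK;
    by rewrite (addrC x) subrK.
have E1 : \int[mu]_y mu (ysection S y) = mu B * mu [set y | A (H y)].
  rewrite -(product_measure2E mu mu mB mHA); apply: eq_integral => y _ /=.
  have [Ay|Ay] := pselect (A (H y)).
    rewrite in_ysectionX ?inE// -(lebesgue_rVD (H y) mB); congr (mu _).
    by apply/seteqP; split=> x; rewrite ysectionE /S /=; [case|].
  rewrite notin_ysectionX ?notin_setE// (_ : ysection S y = set0)//.
  by rewrite -subset0 => x /ysectionP[].
have E2 : \int[mu]_y mu (ysection S' y) = mu A * mu [set y | B (H y)].
  rewrite -(product_measure2E mu mu mA mHB); apply: eq_integral => y _ /=.
  have [By|By] := pselect (B (H y)).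
    rewrite in_ysectionX ?inE// -(lebesgue_rVB (H y) mA); congr (mu _).
    by apply/seteqP; split=> x; rewrite ysectionE /S' /=; [case|].
  rewrite notin_ysectionX ?notin_setE// (_ : ysection S' y = set0)//.
  by rewrite -subset0 => x /ysectionP[].
(* The volume of the ball is finite and positive, so it cancels. *)
have muB : mu B = (kappa n)%:E by rewrite kappaE.
move: E; rewrite E1 E2 HB [RHS]muleC muB => /(congr1 (fun z => (kappa n)^-1%:E * z)).
by rewrite !muleA -EFinM mulVf ?gt_eqF ?kappa_gt0// !mul1e.
Qed.

End linear_isometries.

(** * Volumes by slices *)

Section cones.
Context {R : realType}.
Implicit Types (p q u v : R).

Lemma integral_affine_exp n p q u v : (u < v)%R -> (q != 0)%R ->
  (\int[@lebesgue_measure R]_(x in `[u, v]) ((p + q * x) ^+ n)%:E =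
   (((p + q * v) ^+ n.+1 - (p + q * u) ^+ n.+1) / (q * n.+1%:R))%:E)%E.
Proof.
move=> uv q0; pose P : {poly R} := ((q * n.+1%:R)^-1 *: (p%:P + q *: 'X) ^+ n.+1)%R.
have PE x : horner P x = ((p + q * x) ^+ n.+1 / (q * n.+1%:R))%R.
  by rewrite /P !hornerE mulrC.
rewrite (@continuous_FTC2 _ _ (horner P))//.
- by rewrite !PE -EFinB -mulrBl.
- apply: continuous_subspaceT => x.
  rewrite (_ : (fun _ => _) = horner ((p%:P + q *: 'X) ^+ n)).
    exact: continuous_horner.
  by apply/funext => y; rewrite !hornerE.
- split=> [x _||]; first exact: derivable_horner.
    by apply: cvg_at_right_filter; exact: continuous_horner.
  by apply: cvg_at_left_filter; exact: continuous_horner.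
- move=> x _; rewrite -derivE /P derivZ deriv_exp derivD derivC derivZ derivX /=.
  rewrite hornerZ hornerMn !hornerE -[X in _ * X]mulr_natl.
  by field; rewrite q0 addrC natr1 pnatr_eq0.
Qed.

Lemma enorm_le_sqr n (x : 'rV[R]_n) r : (0 <= r)%R -> (enorm x <= r)%R = (dotv x x <= r ^+ 2)%R.
Proof.
by move=> r0; rewrite /enorm -{1}(ger0_norm r0) -sqrtr_sqr ler_sqrt ?sqr_ge0.
Qed.

Lemma enorm_ge0 n (x : 'rV[R]_n) : 0 <= enorm x.
Proof. exact: sqrtr_ge0. Qed.

Lemma enorm_sqr n (x : 'rV[R]_n) : enorm x ^+ 2 = dotv x x.
Proof. by rewrite sqr_sqrtr ?dotv_ge0. Qed.

Lemma enormZ n a (x : 'rV[R]_n) : enorm (a *: x) = `|a| * enorm x.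
Proof.
by rewrite /enorm dotvZl dotvZr mulrA -expr2 sqrtrM ?sqr_ge0// sqrtr_sqr.
Qed.

Lemma dotv_cons n (s : R) (y : 'rV[R]_n) :
  dotv (rV_cons (s, y)) (rV_cons (s, y)) = s ^+ 2 + dotv y y.
Proof.
rewrite /dotv big_ord_recl !mxE unlift_none /= -expr2; congr (_ + _).
by apply: eq_bigr => i _; rewrite !mxE liftK.
Qed.

Lemma dotv_delta0_cons n (s : R) (y : 'rV[R]_n) :
  dotv (delta_mx 0 0) (rV_cons (s, y)) = s.
Proof.
rewrite /dotv big_ord_recl !mxE unlift_none /= mul1r big1 ?addr0// => i _.
by rewrite !mxE /= mul0r.
Qed.

Local Open Scope ereal_scope.

Lemma lebesgue_rV_slices n (A : set 'rV[R]_n.+1) :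
  lebesgue_rV n.+1 A =
  \int[@lebesgue_measure R]_s lebesgue_rV n [set y | A (rV_cons (s, y))].
Proof. by apply: eq_integral => s _ /=; rewrite xsectionE. Qed.

Lemma measurable_lebesgue_slices n (A : set 'rV[R]_n.+1) : measurable A ->
  measurable_fun setT (fun s => lebesgue_rV n [set y | A (rV_cons (s, y))]).
Proof.
move=> mA; have mA' : measurable (@rV_cons R n @^-1` A).
  by rewrite -[X in measurable X]setTI; exact: measurable_rV_cons.
have := measurable_fun_xsection (lebesgue_rV n) mA'.
by congr measurable_fun; apply/funext => s /=; rewrite xsectionE.
Qed.

Lemma measurable_slice n (A : set 'rV[R]_n.+1) s : measurable A ->
  measurable [set y | A (rV_cons (s, y))].
Proof.
move=> mA; rewrite (_ : [set y | _] = xsection (@rV_cons R n @^-1` A) s).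
  by apply: measurable_xsection; rewrite -[X in measurable X]setTI; exact: measurable_rV_cons.
by rewrite xsectionE.
Qed.

Lemma measurable_enorm_le n r : measurable [set y : 'rV[R]_n | (enorm y <= r)%R].
Proof.
rewrite (_ : [set _ | _] = setT `&` (@enorm R n) @^-1` [set` `]-oo, r]]).
  by apply: measurable_enorm.
by apply/seteqP; split=> x /=; rewrite in_itv/=; [|case].
Qed.

Lemma lebesgue_rV_ball n r : (0 <= r)%R ->
  lebesgue_rV n [set y : 'rV[R]_n | (enorm y <= r)%R] = (r ^+ n * kappa n)%:E.
Proof.
rewrite le_eqVlt => /predU1P[<-|r0].
  (* Radius [0] cannot be reached by scaling; in dimension [0] the ball is the whole space and
     [0 ^+ 0 = 1]. *)
  case: n => [|n].
    rewrite expr0 mul1r kappaE; congr (lebesgue_rV _ _).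
    by apply/seteqP; split=> y; rewrite /eball /= /enorm /dotv big_ord0 sqrtr0.
  rewrite expr0n mul0r; apply/eqP; rewrite eq_le measure_ge0 andbT.
  have m0 : measurable ([set 0%R] : set (measurableTypeR R)) by [].
  rewrite [leRHS](_ : _ = lebesgue_rV n.+1 [set x : 'rV[R]_n.+1 | forall i, [set 0%R] (x 0%R i)]).
    apply: le_measure; rewrite ?inE; [exact: measurable_enorm_le|exact: measurable_box|].
    move=> y /=; rewrite enorm_le_sqr// expr0n/= => y0 i.
    have /eqP : dotv y y == 0%R by rewrite eq_le y0 dotv_ge0.
    by move=> /eqP; rewrite dotv_eq0 => /eqP ->; rewrite mxE.
  by rewrite (lebesgue_rV_box (fun=> m0)) big_ord_recl /= lebesgue_measure_set1 mul0e.
have r_neq0 : (r != 0)%R by rewrite gt_eqF.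
rewrite (lebesgue_rV_affine 0 r_neq0); last exact: measurable_enorm_le.
rewrite gtr0_norm// EFinM kappaE; congr (_ * lebesgue_rV _ _).
by apply/seteqP; split=> y; rewrite /eball /= addr0 enormZ gtr0_norm// ger_pMr.
Qed.

(** The slice at height [s] lies in a ball of radius [p + q * s]; integrating the volumes of these
    balls gives that of a truncated cone. *)
Lemma cone_volume_le n (A : set 'rV[R]_n.+1) p q u v : (u < v)%R -> (q != 0)%R ->
  measurable A ->
  (forall s y, A (rV_cons (s, y)) -> (u <= s <= v)%R /\ (enorm y <= p + q * s)%R) ->
  (forall s, u <= s <= v -> 0 <= p + q * s)%R ->
  lebesgue_rV n.+1 A <=
  (kappa n * (((p + q * v) ^+ n.+1 - (p + q * u) ^+ n.+1) / (q * n.+1%:R)))%:E.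
Proof.
move=> uv q0 mA AP pq0; rewrite lebesgue_rV_slices.
have mD : measurable (`[u, v]%classic : set (measurableTypeR R)) by exact: measurable_itv.
have mg (D : set (measurableTypeR R)) :
    measurable_fun D (fun s : measurableTypeR R => ((p + q * s) ^+ n)%:E).
  apply/measurable_EFinP; apply: measurable_funX.
  by apply: measurable_funD => //; exact: measurable_funM.
have g0 s : `[u, v]%classic s -> 0 <= ((p + q * s) ^+ n)%:E.
  by rewrite /= in_itv/= lee_fin => suv; rewrite exprn_ge0// pq0.
rewrite EFinM -integral_affine_exp// -ge0_integralZl// ?lee_fin ?kappa_ge0//.
rewrite [leRHS]integral_mkcond; apply: ge0_le_integral => //.
- exact: measurable_lebesgue_slices.
- apply/(measurable_restrictT _ _).1 => //.
  exact: measurable_funeM.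
move=> s _; rewrite patchE; case: ifPn => [/set_mem|/negP]; rewrite ?inE /= ?in_itv/= => suv.
  rewrite -EFinM mulrC -lebesgue_rV_ball ?pq0//; apply: le_measure; rewrite ?inE.
  - exact: measurable_slice.
  - exact: measurable_enorm_le.
  - by move=> y /AP[].
rewrite (_ : [set y | _] = set0) ?measure0//.
by rewrite -subset0 => y /AP[].
Qed.

(** Slices at heights in [[-1, 1]] lie in the unit ball one dimension lower; the others are
    empty. *)
Lemma kappaS_le n : (kappa n.+1 <= 2 * kappa n :> R)%R.
Proof.
rewrite -lee_fin kappaE lebesgue_rV_slices EFinM muleC.
rewrite (_ : 2%:E = \int[@lebesgue_measure R]_(x in `[(-1)%R, 1%R]) cst 1 x); last first.
  rewrite integral_cst//= mul1e lebesgue_measure_itv/= lte_fin.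
  by rewrite ifT -?EFinB; [congr EFin|]; lra.
rewrite -ge0_integralZl// ?lee_fin ?kappa_ge0//.
rewrite [leRHS]integral_mkcond; apply: ge0_le_integral => //.
- by apply: measurable_lebesgue_slices; exact: measurable_eball.
- by apply/(measurable_restrictT _ _).1.
move=> s _; rewrite patchE; case: ifPn => [/set_mem|/negP]; rewrite ?inE /= ?in_itv/= => suv.
  rewrite mule1 kappaE; apply: le_measure; rewrite ?inE.
  - by apply: measurable_slice; exact: measurable_eball.
  - exact: measurable_eball.
  - move=> y; rewrite /eball /= !enorm_le_sqr// dotv_cons.
    by have := sqr_ge0 s; lra.
rewrite (_ : [set y | _] = set0) ?measure0//.
rewrite -subset0 => y; rewrite /eball /= enorm_le_sqr// dotv_cons expr1n => h; apply: suv.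
have y0 := dotv_ge0 y; rewrite -ler_norml -(@ler_pXn2r _ 2)// ?nnegrE// expr1n.
by rewrite real_normK ?num_real//; lra.
Qed.
End cones.

(** * Sectors over spherical caps *)

Section spherical_sectors.
Context {R : realType}.

(** Householder reflection in the hyperplane orthogonal to [a]; for [a = 0] it is the identity. *)
Definition reflection n (a x : 'rV[R]_n) : 'rV[R]_n :=
  x - (2 * dotv a x / dotv a a) *: a.

Lemma reflectionD n (a x y : 'rV[R]_n) :
  reflection a (x + y) = reflection a x + reflection a y.
Proof.
by rewrite /reflection dotvDr mulrDr mulrDl scalerDl opprD addrACA.
Qed.

Lemma dotv_reflection n (a x : 'rV[R]_n) : dotv a (reflection a x) = - dotv a x.
Proof.
have [->|a0] := eqVneq a 0; first by rewrite !dotv0l oppr0.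
rewrite /reflection dotvBr dotvZr divfK ?dotv_eq0//; lra.
Qed.

Lemma reflectionK n (a : 'rV[R]_n) : involutive (reflection a).
Proof.
move=> x; rewrite {1}/reflection dotv_reflection mulrN mulNr scaleNr opprK.
by rewrite /reflection subrK.
Qed.

Lemma enorm_reflection n (a x : 'rV[R]_n) : enorm (reflection a x) = enorm x.
Proof.
congr Num.sqrt; rewrite {1}/reflection dotvBl dotvZl dotv_reflection.
by rewrite /reflection dotvBr dotvZr (dotvC x a) mulrN opprK subrK.
Qed.

Lemma measurable_reflection n (a : 'rV[R]_n) : measurable_fun setT (reflection a).
Proof.
rewrite (_ : reflection a =
    fun x => x + (- (2 * dotv a x / dotv a a)) *: a)%R; last first.
  by apply/funext => x; rewrite scaleNr.
apply: measurable_rVD => //; apply: measurable_rVZ => //.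
apply: measurableT_comp => //; apply: measurable_funM => //.
by apply: measurable_funM => //; exact: measurable_dotv.
Qed.

(** This reflection is self-adjoint and exchanges the unit vectors [e] and [w]. *)
Lemma dotv_reflection_swap n (e w x : 'rV[R]_n) : dotv e e = 1 -> dotv w w = 1 ->
  dotv e (reflection (w - e) x) = dotv w x.
Proof.
move=> e1 w1; have [we|we] := eqVneq w e.
  by rewrite we subrr /reflection scaler0 subr0.
have : dotv (w - e) (w - e) != 0 by rewrite dotv_eq0 subr_eq0.
move=> n0; rewrite /reflection (dotvBr e x) dotvZr.
move: n0; rewrite !dotvBr !dotvBl e1 w1 (dotvC w e) => n0.
by field.
Qed.

(** The part of the ball over a cap. The strict inequality excludes the origin, which has no
    direction. *)
Definition sector n (v : 'rV[R]_n) (c : R) : set 'rV[R]_n :=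
  [set x | c * enorm x < dotv v x] `&` eball.

Lemma measurable_sector n (v : 'rV[R]_n) c : measurable (sector v c).
Proof.
apply: measurableI; last exact: measurable_eball.
rewrite (_ : [set x | _] = [set x : 'rV[R]_n | 0 < dotv v x - c * enorm x]); last first.
  by apply/seteqP; split=> x /=; rewrite subr_gt0.
have : measurable_fun setT (fun x : 'rV[R]_n => dotv v x - c * enorm x : measurableTypeR R).
  apply: measurable_funB; first exact: measurable_dotv.
  by apply: measurable_funM => //; exact: measurable_enorm.
move=> /(_ measurableT `]0, +oo[%classic (measurable_itv _)); congr measurable.
by apply/seteqP; split=> x /=; rewrite in_itv/= andbT; [case|].
Qed.

Local Open Scope ereal_scope.

(* The sector is covered by the cone from the origin over its rim and by the
   cone tangent to the sphere along the rim, with apex at distance 1/c. *)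
Lemma sector_delta_volume_le m c : (0 < c < 1)%R ->
  lebesgue_rV m.+1 (sector (delta_mx 0 0)%R c) <=
  (kappa m * (Num.sqrt (1 - c ^+ 2) ^+ m / (c * m.+1%:R)))%:E.
Proof.
move=> /andP[c0 c1]; set t := Num.sqrt _; set S := sector _ _.
have cc : (c ^+ 2 < 1)%R by rewrite expr_lt1// ltW.
have t0 : (0 < t)%R by rewrite sqrtr_gt0; lra.
have t2 : (t ^+ 2 = 1 - c ^+ 2)%R by rewrite sqr_sqrtr//; lra.
have cV : (c < c^-1)%R by rewrite -(ltr_pM2r c0) mulVf ?gt_eqF// -expr2.
pose hd (x : 'rV[R]_m.+1) := dotv (delta_mx 0 0)%R x.
have mhd (I : interval R) : measurable [set x : 'rV[R]_m.+1 | [set` I] (hd x)].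
  have : measurable_fun setT (hd : 'rV[R]_m.+1 -> measurableTypeR R).
    exact: measurable_dotv.
  by move=> /(_ measurableT [set` I] (measurable_itv _)); rewrite setTI.
have mS : measurable S by exact: measurable_sector.
(* The hyperplane through the rim, at height [c], separates the parts covered by the two cones. *)
pose S1 := S `&` [set x | [set` `]-oo, c]] (hd x)].
pose S2 := S `&` [set x | [set` `]c, +oo[] (hd x)].
have mS1 : measurable S1 by apply: measurableI => //; exact: mhd.
have mS2 : measurable S2 by apply: measurableI => //; exact: mhd.
have SE : S = S1 `|` S2.
  rewrite /S1 /S2 -setIUr (_ : _ `|` _ = setT) ?setIT//.
  apply/seteqP; split=> // x _ /=; rewrite !in_itv/= andbT.
  by case: leP; [left|right].
have SP s y : S (rV_cons (s, y)) -> [/\ (0 < s)%R, (c ^+ 2 * (s ^+ 2 + dotv y y) < s ^+ 2)%R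
    & (s ^+ 2 + dotv y y <= 1)%R].
  move=> [/=]; rewrite dotv_delta0_cons => h; rewrite /eball /= enorm_le_sqr//.
  rewrite dotv_cons expr1n => h1.
  have e0 := enorm_ge0 (rV_cons (s, y)).
  have s0 : (0 < s)%R by apply: le_lt_trans h; rewrite mulr_ge0// ltW.
  split=> //; rewrite -dotv_cons -enorm_sqr -exprMn ltr_pXn2r ?nnegrE ?(ltW s0)//.
  by rewrite mulr_ge0// (ltW c0).
have V1 : lebesgue_rV m.+1 S1 <=
    (kappa m * (((0 + t / c * c) ^+ m.+1 - (0 + t / c * 0) ^+ m.+1) / (t / c * m.+1%:R)))%:E.
  apply: cone_volume_le => //; first by rewrite mulf_neq0 ?invr_neq0 ?gt_eqF.
    move=> s y [/SP[s0 h1 h2]]; rewrite /= /hd dotv_delta0_cons in_itv/= => sc.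
    rewrite (ltW s0) sc; split=> //; rewrite add0r enorm_le_sqr; last first.
      by rewrite mulr_ge0 ?divr_ge0 ?ltW.
    rewrite exprMn expr_div_n t2 mulrAC ler_pdivlMr ?exprn_gt0//; lra.
  by move=> s /andP[s0 _]; rewrite add0r mulr_ge0// divr_ge0 ?ltW.
have V2 : lebesgue_rV m.+1 S2 <=
    (kappa m * (((t^-1 + - (c / t) * c^-1) ^+ m.+1 - (t^-1 + - (c / t) * c) ^+ m.+1) /
                (- (c / t) * m.+1%:R)))%:E.
  (* Radius of the tangent cone: [t] at the rim and [0] at the apex [s = c^-1]. *)
  have pE s : (t^-1 + - (c / t) * s = (1 - c * s) / t)%R by field; rewrite gt_eqF.
  apply: cone_volume_le => //; first by rewrite oppr_eq0 mulf_neq0 ?invr_neq0 ?gt_eqF.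
    move=> s y [/SP[s0 h1 h2]]; rewrite /= /hd dotv_delta0_cons in_itv/= andbT => sc.
    have y0 := dotv_ge0 y.
    have s1 : (s <= 1)%R.
      by rewrite -(@ler_pXn2r _ 2) ?nnegrE ?(ltW s0)// expr1n; lra.
    have cs : (c * s <= 1)%R.
      by apply: le_trans s1; rewrite ler_piMl ?(ltW s0) ?(ltW c1).
    rewrite (ltW sc) -div1r ler_pdivlMr// mulrC cs; split=> //.
    rewrite pE enorm_le_sqr; last by rewrite divr_ge0 ?subr_ge0 ?(ltW t0).
    rewrite expr_div_n t2 ler_pdivlMr; last by lra.
    have h3 : (dotv y y * (1 - c ^+ 2) <= (1 - s ^+ 2) * (1 - c ^+ 2))%R.
      by rewrite ler_pM2r; lra.
    (* The square is the difference of [(1 - c * s) ^+ 2] and [(1 - s ^+ 2) * (1 - c ^+ 2)]. *)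
    by have := sqr_ge0 (s - c)%R; nra.
  move=> s /andP[_ sc]; rewrite pE divr_ge0 ?(ltW t0)// subr_ge0 mulrC.
  by rewrite -ler_pdivlMr// div1r.
rewrite SE; apply: le_trans (measureU2 _ mS1 mS2) _.
apply: le_trans (leeD V1 V2) _; rewrite -EFinD -mulrDr lee_fin ler_wpM2l ?kappa_ge0//.
rewrite le_eqVlt; apply/orP; left; apply/eqP.
have m0 : (m.+1%:R != 0 :> R)%R by rewrite pnatr_eq0.
have c_neq0 : (c != 0)%R by rewrite gt_eqF.
have t_neq0 : (t != 0)%R by rewrite gt_eqF.
rewrite (_ : 0 + t / c * c = t)%R; last by rewrite add0r divfK.
rewrite (_ : t^-1 + - (c / t) * c^-1 = 0)%R; last by field; rewrite c_neq0.
rewrite (_ : t^-1 + - (c / t) * c = t)%R; last first.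
  by apply: (mulIf t_neq0); rewrite -expr2 t2; field.
rewrite mulr0 add0r !expr0n /= !sub0r subr0 !exprS.
(* The cones have heights [c] and [1/c - c] over a base of radius [t]; the heights sum to [1/c]. *)
have -> : (t * t ^+ m / (t / c * m.+1%:R) + - (t * t ^+ m) / (- (c / t) * m.+1%:R) =
    t ^+ m * (c ^+ 2 + t ^+ 2) / (c * m.+1%:R))%R.
  by move: m0; move: (m.+1%:R) => M m0; field; rewrite m0 c_neq0 t_neq0.
by rewrite t2 addrC subrK mulr1.
Qed.

(** Normalizing [v] enlarges the sector, and a reflection carries its axis to the first coordinate
    axis. Then [1 - c ^+ 2 <= 2 * (1 - c)] bounds the radius of the rim by the chord, and
    [2^-1 <= c] bounds [1/c] by [2]. *)
Lemma sector_volume_le m (v : 'rV[R]_m.+1) c : (2^-1 <= c < 1)%R -> (enorm v <= 1)%R ->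
  lebesgue_rV m.+1 (sector v c) <=
  (2 * kappa m * Num.sqrt (2 * (1 - c)) ^+ m / m.+1%:R)%:E.
Proof.
move=> /andP[c2 c1] v1; have c0 : (0 < c)%R by lra.
have [->|v_neq0] := eqVneq v 0%R.
  rewrite (_ : sector _ _ = set0) ?measure0 ?lee_fin.
    by rewrite divr_ge0 ?mulr_ge0 ?exprn_ge0 ?kappa_ge0 ?sqrtr_ge0.
  rewrite -subset0 => x [/=]; rewrite dotv0l => h.
  by have := mulr_ge0 (ltW c0) (enorm_ge0 x); rewrite leNgt h.
have ev : (0 < enorm v)%R by rewrite sqrtr_gt0 dotv_gt0.
pose w := ((enorm v)^-1 *: v)%R; pose e : 'rV[R]_m.+1 := (delta_mx 0 0)%R.
have w1 : dotv w w = 1%R.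
  by rewrite dotvZl dotvZr mulrA -invfM -expr2 enorm_sqr mulVf// dotv_eq0.
have e1 : dotv e e = 1%R.
  by rewrite /dotv big_ord_recl big1 ?mxE /= ?mulr1 ?addr0// => i _; rewrite !mxE /= mul0r.
apply: (@le_trans _ _ (lebesgue_rV m.+1 (sector w c))).
  apply: le_measure; rewrite ?inE; [exact: measurable_sector..|].
  move=> x [/= h xB]; split=> //=; apply: (lt_le_trans h).
  rewrite dotvZl ler_peMl//; last by rewrite invf_ge1.
  by apply: le_trans (ltW h); rewrite mulr_ge0 ?(ltW c0)// enorm_ge0.
rewrite (_ : sector w c = [set x | sector e c (reflection (w - e)%R x)]); last first.
  by apply/seteqP; split=> x [/= h xB]; split=> /=;
    move: h xB; rewrite /eball /= enorm_reflection ?dotv_reflection_swap.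
rewrite lebesgue_rV_involutive_isometry; last first.
- exact: measurable_sector.
- exact: measurable_reflection.
- exact: enorm_reflection.
- exact: reflectionK.
- exact: reflectionD.
apply: le_trans (sector_delta_volume_le m _) _; first by rewrite c0.
set T := Num.sqrt _; set S := Num.sqrt _; have M0 : (0 < m.+1%:R :> R)%R by [].
have TS : (T ^+ m <= S ^+ m)%R.
  rewrite lerXn2r ?nnegrE ?sqrtr_ge0// ler_sqrt; last by lra.
  by have := mulr_ge0 (ltW c0) (ltW c0); rewrite expr2; nra.
have S0 : (0 <= S ^+ m)%R by rewrite exprn_ge0 ?sqrtr_ge0.
move: M0; move: (m.+1%:R : R) => M M0; rewrite lee_fin.
rewrite [leRHS](_ : _ = kappa m * (2 * S ^+ m / M))%R; last by ring.
rewrite ler_wpM2l ?kappa_ge0// invfM mulrA ler_pM2r ?invr_gt0// ler_pdivrMr//.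
by have := mulr_ge0 (_ : 0 <= c - 2^-1)%R S0; rewrite subr_ge0 c2 => /(_ isT); lra.
Qed.

End spherical_sectors.

(** * Spherical caps and dual volumes *)

Section integral_bounds.
Context {R : realType} d (T : measurableType d) (mu : {measure set T -> \bar R}).
Local Open Scope ereal_scope.

(** Compares the suprema over simple functions directly, so that it applies to functions not known
    to be measurable. *)
Lemma ge0_le_integralT (f g : T -> \bar R) : (forall x, 0 <= f x) ->
  (forall x, f x <= g x) -> \int[mu]_x f x <= \int[mu]_x g x.
Proof.
move=> f0 fg; have g0 x : 0 <= g x by exact: le_trans (fg x).
rewrite !ge0_integralTE//; apply: ereal_sup_le => _ [h hf <-]; exists h => //= x.
exact: le_trans (fg x).
Qed.

(** Meant for integrands built from radial functions, whose measurability is not established. The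
    bound [b] keeps the integral finite; [Rintegral] would turn an infinite value into [0]. *)
Lemma Rintegral_ge_cst (D G : set T) (f : T -> R) (a b : R) :
  measurable D -> measurable G -> G `<=` D -> mu D < +oo -> (0 <= a)%R ->
  (forall x, D x -> (0 <= f x <= b)%R) -> (forall x, G x -> (a <= f x)%R) ->
  (a * fine (mu G) <= Rintegral mu D f)%R.
Proof.
move=> mD mG GD Doo a0 fb fa.
have muG : mu G \is a fin_num.
  by rewrite ge0_fin_numE//; apply: le_lt_trans Doo; apply: le_measure; rewrite ?inE.
have muD : mu D \is a fin_num by rewrite ge0_fin_numE.
have lo : (a * fine (mu G))%:E <= \int[mu]_(x in D) (f x)%:E.
  rewrite EFinM fineK// -integral_cst//.
  rewrite integral_mkcond [leRHS]integral_mkcond.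
  apply: ge0_le_integralT => x; rewrite !patchE.
    by case: ifP => // _; rewrite lee_fin.
  case: ifPn => [/set_mem Gx|_]; first by rewrite mem_set ?lee_fin ?fa//; exact: GD.
  by case: ifPn => // /set_mem/fb /andP[]; rewrite lee_fin.
have hi : \int[mu]_(x in D) (f x)%:E <= (b * fine (mu D))%:E.
  rewrite EFinM fineK// -integral_cst//.
  rewrite integral_mkcond [leRHS]integral_mkcond.
  apply: ge0_le_integralT => x; rewrite !patchE.
    by case: ifPn => // /set_mem/fb /andP[]; rewrite lee_fin.
  by case: ifPn => // /set_mem/fb /andP[]; rewrite lee_fin.
have fin : \int[mu]_(x in D) (f x)%:E \is a fin_num.
  by rewrite fin_numE; apply/andP; split; apply/eqP => E; move: lo hi; rewrite E ?leye_eq ?leeNy_eq.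
by rewrite -lee_fin /Rintegral fineK.
Qed.

End integral_bounds.

Section caps.
Context {R : realType} {m : nat}.
Let d := m.+1.
Implicit Types (v u : 'rV[R]_d) (V : seq 'rV[R]_d).
Local Open Scope ereal_scope.

Definition cap v (c : R) : set 'rV[R]_d := [set u | (c < dotv v u)%R].

Lemma measurable_cap v c : measurable (cap v c).
Proof.
have : measurable_fun setT (dotv v : 'rV[R]_d -> measurableTypeR R) by exact: measurable_dotv.
move=> /(_ measurableT `]c, +oo[%classic (measurable_itv _)); congr measurable.
by apply/seteqP; split=> x /=; rewrite in_itv/= andbT; [case|].
Qed.

Lemma cap_prob_le v c : (2^-1 <= c < 1)%R -> (enorm v <= 1)%R ->
  @sphere_prob R d (cap v c) <=
  (2 * kappa m * Num.sqrt (2 * (1 - c)) ^+ m / omega d)%:E.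
Proof.
move=> c1 v1; rewrite /sphere_prob.
(* The origin is in neither set: [direction] sends it to [0], which is outside the cap because
   [c > 0]. *)
have -> : direction @^-1` cap v c `&` eball = sector v c.
  congr (_ `&` _); apply/seteqP; split=> x; rewrite /cap /= /direction dotvZr.
    have [->|x0] := eqVneq x 0%R; first by rewrite dotv0r mulr0; case/andP: c1; lra.
    by rewrite mulrC ltr_pdivlMr// sqrtr_gt0 dotv_gt0.
  have [->|x0] := eqVneq x 0%R.
    by rewrite dotv0r /enorm dotv0r sqrtr0 mulr0 ltxx.
  by rewrite [X in (_ -> _ < X)%R]mulrC ltr_pdivlMr// sqrtr_gt0 dotv_gt0.
apply: le_trans (lee_wpmul2l _ (sector_volume_le c1 v1)) _.
  by rewrite lee_fin invr_ge0 kappa_ge0.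
rewrite -EFinM lee_fin /omega invfM le_eqVlt; apply/orP; left; apply/eqP; ring.
Qed.

Definition caps V (c : R) : set 'rV[R]_d := [set u | has (fun v => c < dotv v u)%R V].

Lemma caps_prob_le V c : (2^-1 <= c < 1)%R -> {in V, forall v, (enorm v <= 1)%R} ->
  measurable (caps V c) /\
  @sphere_prob R d (caps V c) <=
  ((size V)%:R * (2 * kappa m * Num.sqrt (2 * (1 - c)) ^+ m / omega d))%:E.
Proof.
move=> c1; elim: V => [|v V IH] V1.
  have -> : caps [::] c = set0 by apply/seteqP; split.
  by split=> //; rewrite mul0r [leLHS]measure0.
have [|mV PV] := IH; first by move=> w wV; apply: V1; rewrite in_cons wV orbT.
have -> : caps (v :: V) c = cap v c `|` caps V c.
  by apply/seteqP; split=> u /=; [move=> /orP|move=> H; apply/orP].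
have mv := measurable_cap v c; split; first exact: measurableU.
apply: le_trans (measureU2 _ mv mV) _.
rewrite /= -add1n natrD mulrDl mul1r EFinD; apply: leeD => //.
by apply: cap_prob_le => //; apply: V1; rewrite mem_head.
Qed.

Lemma measurable_esphere : measurable (@esphere R d).
Proof.
rewrite (_ : esphere = setT `&` @enorm R d @^-1` [set 1%R]).
  by apply: measurable_enorm.
by rewrite setTI.
Qed.

Lemma caps_compl_prob_ge V c : (2^-1 <= c < 1)%R -> {in V, forall v, (enorm v <= 1)%R} ->
  ((size V)%:R * (2 * kappa m * Num.sqrt (2 * (1 - c)) ^+ m / omega d) <= 2^-1)%R ->
  measurable (esphere `\` caps V c) /\
  (2^-1 <= fine (@sphere_prob R d (esphere `\` caps V c)))%R.
Proof.
move=> c1 V1 h; have [mV PV] := caps_prob_le c1 V1.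
have mG : measurable (esphere `\` caps V c) by apply: measurableD => //; exact: measurable_esphere.
split=> //; set G := _ `\` _ in mG *.
have PGT : @sphere_prob R d G <= 1.
  by rewrite -(@sphere_prob_setT R d); apply: le_measure; rewrite ?inE.
have Gfin : @sphere_prob R d G \is a fin_num.
  by rewrite ge0_fin_numE//; apply: le_lt_trans PGT _; rewrite ltry.
rewrite -lee_fin fineK//.
have : 1 <= @sphere_prob R d G + @sphere_prob R d (caps V c).
  rewrite -(@sphere_prob_esphere R d)//; apply: le_trans (measureU2 _ mG mV).
  apply: le_measure; rewrite ?inE; [exact: measurable_esphere|exact: measurableU|].
  by move=> u Su; have [?|?] := pselect (caps V c u); [right|left].
move=> /le_trans/(_ (leeD (lexx _) PV)); rewrite -{1}(fineK Gfin) -EFinD lee_fin.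
rewrite -{2}(fineK Gfin) lee_fin; lra.
Qed.

End caps.

(** * Inequalities for powers and the exponential *)

Section scalar_inequalities.
Context {R : realType}.
Implicit Types (x t q rho : R).

Lemma expRN_le_chord x : 0 <= x <= 1 -> expR (- x) <= 1 - (1 - expR (- 1)) * x.
Proof.
move=> /andP[x0 x1].
have ti : Itv.spec (@Itv.num_sem R) (Itv.Real `[0%Z, 1%Z]) x.
  by rewrite /= /Itv.num_sem /= num_real /= in_itv /= x0 x1.
have := convex_expR (Itv.mk ti) (-1) 0.
rewrite !convRE /= expR0 mulr0 addr0 mulrN1 mulr1 => /le_trans; apply.
by rewrite /unstable.onem; lra.
Qed.

Lemma one_sub_expRN_ge x : 0 <= x ->
  (1 - expR (- 1)) * Num.min 1 x <= 1 - expR (- x).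
Proof.
move=> x0; have [x1|/ltW x1] := leP 1 x.
  by rewrite mulr1 lerD2l lerN2 ler_expR lerN2.
by have := @expRN_le_chord x; rewrite x0 x1 => /(_ isT); lra.
Qed.

(** From [ln rho <= rho - 1 <= - t]: for [q >= 0] the power is at most [expR (- (q * t))], and for
    [q < 0] it is at least [expR (]|q| * t)[, hence at least]1 + [|q| * t]. *)
Lemma norm_1B_powR_ge q t rho : 0 <= t -> 0 < rho -> rho <= 1 - t ->
  (1 - expR (- 1)) * Num.min 1 (`|q| * t) <= `|1 - rho `^ q|.
Proof.
move=> t0 r0 rt; have x0 : 0 <= `|q| * t by rewrite mulr_ge0.
have lnr : ln rho <= - t.
  have := @le_ln1Dx R (rho - 1); rewrite (addrC 1) subrK => /(_ _)/le_trans.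
  by apply; lra.
have e1 : 0 < expR (- 1) :> R by exact: expR_gt0.
have e2 : expR (- 1) <= 1 :> R by rewrite expR_le1; lra.
rewrite /powR gt_eqF//; have [q0|q0] := leP 0 q.
  rewrite ger0_norm// in x0 *; apply: le_trans (one_sub_expRN_ge x0) _.
  apply: le_trans (ler_norm _); rewrite lerD2l lerN2 ler_expR -mulrN.
  by rewrite ler_wpM2l.
rewrite ltr0_norm// in x0 *; rewrite distrC; apply: le_trans (ler_norm _).
have : expR (- q * t) <= expR (q * ln rho).
  by rewrite ler_expR mulNr -mulrN ler_wnM2l// ltW.
have := expR_ge1Dx (- q * t); have : Num.min 1 (- q * t) <= - q * t by rewrite ge_min lexx orbT.
have : 0 <= Num.min 1 (- q * t) by rewrite le_min ler01.
nra.
Qed.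

Lemma Gamma_ge0 x : 0 <= Gamma x.
Proof.
by apply: Rintegral_ge0 => t _; rewrite mulr_ge0 ?powR_ge0 ?expR_ge0.
Qed.

Lemma dual_vol_ball_ge0 n q : 0 <= dual_vol_ball n q.
Proof.
by rewrite !(mulr_ge0, invr_ge0, powR_ge0, Gamma_ge0).
Qed.

End scalar_inequalities.

(** * Bounds for radial functions *)

Section radial_functions.
Context {R : realType} {d : nat}.
Implicit Types (P : set 'rV[R]_d) (u : 'rV[R]_d) (e c : R).

(** Inclusion in the ball bounds the multipliers above; [sup] of an unbounded set would be a default
    value. *)
Lemma radial_ge P e u : 0 < e -> (forall x, enorm x <= e -> P x) -> P `<=` eball ->
  esphere u -> e <= radial P u.
Proof.
move=> e0 eP P1 u1; apply: ub_le_sup.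
  exists 1 => l [l0 /P1]; rewrite /eball /= enormZ u1 mulr1.
  exact/le_trans/ler_norm.
split; first exact: ltW.
by apply: eP; rewrite enormZ u1 mulr1 ger0_norm// ltW.
Qed.

Lemma radial_le P e u c : 0 < e -> (forall x, enorm x <= e -> P x) -> esphere u ->
  (forall l, 0 <= l -> P (l *: u) -> l <= c) -> radial P u <= c.
Proof.
move=> e0 eP u1 lc; apply: ge_sup => [|l [l0 Pl]]; last exact: lc.
exists e; split; first exact: ltW.
by apply: eP; rewrite enormZ u1 mulr1 ger0_norm// ltW.
Qed.

Lemma radial_le1 P e u : 0 < e -> (forall x, enorm x <= e -> P x) -> P `<=` eball ->
  esphere u -> radial P u <= 1.
Proof.
move=> e0 eP P1 u1; apply: (radial_le e0 eP u1) => l l0 /P1.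
by rewrite /eball /= enormZ u1 mulr1; exact/le_trans/ler_norm.
Qed.

Lemma radial_eball u : esphere u -> radial eball u = 1.
Proof.
move=> u1; apply/eqP; rewrite eq_le (@radial_le1 _ 1)//=.
by rewrite (@radial_ge _ 1).
Qed.

(** If [l *: u] is in the hull, then [l], its dot product with [u], is at most that of some vertex
    with [u]. *)
Lemma radial_conv_hull_le (A : seq 'rV[R]_d) e u c : 0 < e ->
  (forall x, enorm x <= e -> conv_hull [set` A] x) -> esphere u ->
  ~~ has (fun v => c < dotv v u) (vertices A) -> radial (conv_hull [set` A]) u <= c.
Proof.
move=> e0 eP u1 /hasPn Vc; apply: (radial_le e0 eP u1) => l l0 /(vertices_max u)[v vV].
rewrite dotvZr -enorm_sqr u1 expr1n mulr1 => /le_trans; apply.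
by rewrite dotvC leNgt Vc.
Qed.

(** Neighbourhoods are those of the sup norm, which the Euclidean norm dominates; halving the radius
    gives the strict inequality of an open ball. *)
Lemma interior_enorm P : interior P 0 ->
  exists2 e, 0 < e & forall x, enorm x <= e -> P x.
Proof.
move=> /nbhs_ballP[e /= e0 eP]; exists (e / 2); first by rewrite divr_gt0.
move=> x xe; apply: eP; rewrite -ball_normE /ball_ /= sub0r normrN.
rewrite [ltLHS]/Num.Def.normr/= mx_normrE; apply: bigmax_lt => //= -[i j] _ /=.
apply: (@le_lt_trans _ _ (e / 2)); last by lra.
apply: le_trans xe; rewrite ord1 -sqrtr_sqr ler_wsqrtr// /dotv (bigD1 j)//= -expr2.
by rewrite lerDl; apply: sumr_ge0 => k _; rewrite -expr2 sqr_ge0.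
Qed.

End radial_functions.

(** * The choice of the cap height *)

Section approximation.
Context {R : realType} {m k M : nat}.
Let d := m.+1.
Implicit Types (P : set 'rV[R]_d).

(** The power [r ^+ m] of the chord [r] for which the bound [2 * kappa m * r ^+ m / omega d] on the
    probability of a cap equals [1 / (2 * M)]. *)
Definition cap_base : R := omega d / (4 * kappa m) / M%:R.

Lemma cap_base_gt0 : (0 < M)%N -> 0 < cap_base.
Proof.
by move=> M0; rewrite !divr_gt0 ?mulr_gt0 ?kappa_gt0 ?ltr0n.
Qed.

(** By [kappaS_le], [omega d] is at most [2 * d * kappa m], and [d <= M]. *)
Lemma cap_base_le1 : (0 < M)%N -> (d <= M)%N -> cap_base <= 1.
Proof.
move=> M0 dM; have k0 : 0 < kappa m :> R by exact: kappa_gt0.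
have M0' : 0 < M%:R :> R by rewrite ltr0n.
rewrite /cap_base ler_pdivrMr// ler_pdivrMr ?mulr_gt0// mul1r /omega.
have dM' : d%:R <= M%:R :> R by rewrite ler_nat.
have := @kappaS_le R m; have := kappa_gt0 d :> 0 < (kappa d : R).
have : 0 <= d%:R :> R by [].
nra.
Qed.

Definition cap_height : R := cap_base `^ (2 / m%:R) / 2.

(* A cap of height t has chord r with r^2 = 2t. *)
Lemma cap_height_root : (0 < m)%N -> (0 < M)%N ->
  Num.sqrt (2 * cap_height) ^+ m = cap_base.
Proof.
move=> m0 M0; have b0 := cap_base_gt0 M0.
rewrite /cap_height mulrC divfK ?pnatr_eq0// -powR12_sqrt ?powR_ge0//.
rewrite -powRrM -powR_mulrn ?powR_ge0// -powRrM.
rewrite (_ : 2 / m%:R / 2 * m%:R = 1) ?powRr1 ?ltW//.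
by field; rewrite pnatr_eq0 -lt0n.
Qed.

Lemma cap_height_gt0 : (0 < M)%N -> 0 < cap_height.
Proof. by move=> M0; rewrite divr_gt0// powR_gt0// cap_base_gt0. Qed.

(** Ensures that [c = 1 - cap_height] is at least [1/2], as the cap estimates require. *)
Lemma cap_height_le : (0 < M)%N -> (d <= M)%N -> cap_height <= 2^-1.
Proof.
move=> M0 dM; rewrite /cap_height ler_pdivrMr// mulVf ?pnatr_eq0//.
apply: le_trans (_ : 1 `^ (2 / m%:R) <= _); last by rewrite powR1.
have q0 : 0 <= 2 / m%:R :> R by rewrite divr_ge0.
by rewrite ge0_ler_powR ?nnegrE ?cap_base_le1 ?(ltW (cap_base_gt0 M0)).
Qed.

Lemma cap_heightE : cap_height =
  (omega d / (4 * kappa m)) `^ (2 / m%:R) * M%:R `^ (- (2 / m%:R)) / 2.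
Proof.
have w0 : 0 <= omega d / (4 * kappa m) :> R by rewrite divr_ge0 ?mulr_ge0 ?kappa_ge0.
rewrite /cap_height /cap_base powRM// ?invr_ge0//; congr (_ * _ / _).
by rewrite -[M%:R^-1]powR_inv1// -powRrM mulN1r.
Qed.

(** [G] is the sphere without the caps around the vertices. The face count gives at most [M]
    vertices; there are at least [d], so [d <= M] and the cap height is at most [1/2]. *)
Lemma radial_small P : (0 < m)%N -> (0 < M)%N -> (k <= d./2)%N ->
  is_polytope P -> P `<=` eball -> interior P 0 -> (faces k P #<= `I_M)%card ->
  exists e G, [/\ 0 < e, forall x, enorm x <= e -> P x, measurable G, G `<=` esphere &
    2^-1 <= fine (@sphere_prob R d G) /\
    forall u, G u -> radial P u <= 1 - cap_height].
Proof.
move=> m0 M0 kd [A0 /finite_seqP[A ->] ->] P1 /interior_enorm[e e0 eP] fM.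
have VM := size_vertices_le e0 eP kd fM; have dV := size_vertices_ge e0 eP.
have dM : (d <= M)%N by exact: leq_trans VM.
have t0 := cap_height_gt0 M0; have t2 := cap_height_le M0 dM.
pose c := 1 - cap_height; have c1 : 2^-1 <= c < 1.
  by rewrite /c; apply/andP; split; lra.
have V1 : {in vertices A, forall v, enorm v <= 1}.
  by move=> v /verticesP[vA _]; apply: P1; exact: sub_gen_smallest.
have [|mG PG] := caps_compl_prob_ge c1 V1.
  rewrite /c opprB addrCA subrr addr0 cap_height_root//.
  have k0 : 0 < kappa m :> R by exact: kappa_gt0.
  have kd0 : 0 < kappa d :> R by exact: kappa_gt0.
  rewrite (_ : 2 * kappa m * cap_base / omega d = 2^-1 / M%:R).
    by rewrite mulrA ler_pdivrMr ?ltr0n// mulrC ler_pM2l ?invr_gt0// ler_nat.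
  rewrite /cap_base /omega; field.
  by rewrite !pnatr_eq0 !gt_eqF// -lt0n M0.
exists e, (esphere `\` caps (vertices A) c); split=> //; split=> // u [u1 uc].
by apply: (radial_conv_hull_le e0 eP u1); apply/negP.
Qed.

End approximation.
Arguments cap_height {R} m M.

(** * Lower bounds for the deviations *)

Section deviations.
Context {R : realType} {m k M : nat} (P : set 'rV[R]_m.+1).
Let d := m.+1.
Hypotheses (m0 : (0 < m)%N) (M0 : (0 < M)%N) (kd : (k <= d./2)%N).
Hypotheses (poly : is_polytope P) (P1 : P `<=` eball) (intP : interior P 0).
Hypothesis fM : (faces k P #<= `I_M)%card.
Let t : R := cap_height m M.

(** The upper bound may depend on the radius [e] of a ball inside [P] and secures finiteness; the
    lower bound [a] is integrated over a set of probability at least [1/2]. *)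
Lemma sphere_mean_ge (f : 'rV[R]_d -> R) (a : R) : 0 <= a ->
  (forall e, 0 < e -> exists b, forall u, esphere u -> e <= radial P u <= 1 ->
    0 <= f u <= b) ->
  (forall u, esphere u -> 0 < radial P u <= 1 - t -> a <= f u) ->
  a / 2 <= sphere_mean f.
Proof.
move=> a0 fb fa.
have [e [G [e0 eP mG GS [PG rG]]]] := radial_small m0 M0 kd poly P1 intP fM.
have re u : esphere u -> e <= radial P u <= 1.
  by move=> u1; rewrite (radial_ge e0 eP P1 u1) (radial_le1 e0 eP P1 u1).
have [b fB] := fb e e0.
apply: (@le_trans _ _ (a * fine (@sphere_prob R d G))); first by rewrite ler_wpM2l.
apply: (@Rintegral_ge_cst _ _ _ _ _ _ _ _ b) => //.
- exact: measurable_esphere.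
- by rewrite [ltLHS]sphere_prob_esphere ?ltry.
- by move=> u u1; apply: fB => //; exact: re.
- move=> u Gu; have u1 := GS _ Gu; apply: fa => //.
  by have /andP[+ _] := re _ u1; move=> /(lt_le_trans e0) ->; exact: rG.
Qed.

Lemma sphere_mean_powR_ge q :
  (1 - expR (- 1)) * Num.min 1 (`|q| * t) / 2 <=
  sphere_mean (fun u => `|radial eball u `^ q - radial P u `^ q|).
Proof.
have e1 : expR (- 1) <= 1 :> R by rewrite expR_le1; lra.
have t0 : 0 <= t by rewrite ltW// cap_height_gt0.
apply: sphere_mean_ge.
- by rewrite mulr_ge0 ?subr_ge0// le_min ler01 mulr_ge0.
- move=> e e0; exists (1 + (1 + e `^ q)) => u u1 /andP[eu ue]; rewrite normr_ge0/=.
  rewrite radial_eball// powR1; apply: le_trans (ler_normB _ _) _.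
  rewrite normr1 lerD2l ger0_norm ?powR_ge0//.
  have u0 : 0 < radial P u by exact: lt_le_trans eu.
  have [q0|q0] := leP 0 q.
    apply: ler_wpDr; first exact: powR_ge0.
    apply: le_trans (_ : 1 `^ q <= _); last by rewrite powR1.
    by rewrite ge0_ler_powR ?nnegrE// ltW.
  apply: ler_wpDl => //; rewrite -(opprK q) !(powRN _ (- q)).
  rewrite lef_pV2 ?posrE ?powR_gt0//.
  by rewrite ge0_ler_powR ?nnegrE ?oppr_ge0 ?(ltW e0) ?(ltW u0) ?(ltW q0).
move=> u u1 /andP[u0 ut]; rewrite radial_eball// powR1.
exact: norm_1B_powR_ge.
Qed.

Lemma dual_dev0_ge : t / 2 <= dual_dev0 eball P.
Proof.
have t0 : 0 < t by exact: cap_height_gt0.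
(* As [P] lies in the ball, the intersection is [P]; the ball contributes [ln 1 = 0], and one of the
   two copies of [dual_vol0 P] cancels. *)
have -> : dual_dev0 eball P = sphere_mean (fun u => - ln (radial P u)).
  rewrite /dual_dev0 setIidr// (_ : dual_vol0 eball = 0); last first.
    rewrite /dual_vol0 /sphere_mean (@eq_Rintegral _ _ _ _ _ (cst 0)).
      by rewrite /Rintegral integral0_eq.
    by move=> u /set_mem u1; rewrite radial_eball// ln1.
  have -> : dual_vol0 P = - sphere_mean (fun u => - ln (radial P u)).
    rewrite /dual_vol0 /sphere_mean /Rintegral -fineN; congr fine.
    have [e [G [e0 eP _ _ _]]] := radial_small m0 M0 kd poly P1 intP fM.
    rewrite -integral_ge0N; last first.
      by move=> u u1; rewrite lee_fin oppr_ge0 ln_le0//; exact: radial_le1 e0 eP P1 u1.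
    by apply: eq_integral => u _; rewrite EFinN oppeK.
  lra.
apply: sphere_mean_ge; first exact: ltW.
- move=> e e0; exists (- ln e) => u u1 /andP[eu ue].
  rewrite oppr_ge0 ln_le0//= lerN2 ler_ln ?posrE//.
  exact: lt_le_trans eu.
- move=> u u1 /andP[u0 ut].
  (* Uses [ln rho <= rho - 1 <= - t]. *)
  have := @le_ln1Dx R (radial P u - 1); rewrite (addrC 1) subrK => /(_ _) h.
  by have := h _; lra.
Qed.

End deviations.

Theorem theorem3p7 (R : realType) (d k M : nat) (q : R) (P : set 'rV[R]_d) :
  (2 <= d)%N -> (k <= d./2)%N -> (0 < M)%N ->
  is_polytope P -> P `<=` eball -> interior P 0 -> (faces k P #<= `I_M)%card ->
  [/\ 0 < `|q| -> `|q| <= d%:R ->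
        dual_dev q eball P >=
          (1 - expR (- 1)) / 2 * dual_vol_ball d `|q| *
          Num.min 1 (`|q| / 2 *
            (omega d / (4 * kappa d.-1)) `^ (2 / (d%:R - 1)) *
            M%:R `^ (- (2 / (d%:R - 1)))),
      `|q| > d%:R ->
        dual_dev q eball P >=
          (1 - expR (- 1)) / 2 * kappa d *
          Num.min 1 (`|q| / 2 *
            (omega d / (4 * kappa d.-1)) `^ (2 / (d%:R - 1)) *
            M%:R `^ (- (2 / (d%:R - 1))))
    & q = 0 ->
        dual_dev0 eball P >=
          4^-1 * (omega d / (4 * kappa d.-1)) `^ (2 / (d%:R - 1)) *
          M%:R `^ (- (2 / (d%:R - 1)))].
Proof.
case: d P => // m P; rewrite ltnS => m0 kd M0 poly P1 intP fM.
rewrite [m.+1.-1]/= (_ : m.+1%:R - 1 = m%:R :> R); last by rewrite -natr1 addrK.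
(* The second entry of each minimum is [|q|] times the cap height. *)
have qt : `|q| / 2 * (omega m.+1 / (4 * kappa m)) `^ (2 / m%:R) * M%:R `^ (- (2 / m%:R)) =
    `|q| * cap_height m M.
  by rewrite cap_heightE; ring.
have mean := sphere_mean_powR_ge m0 M0 kd poly P1 intP fM q.
rewrite qt; split.
- move=> _ qd; rewrite /dual_dev /c1 qd.
  apply: le_trans (ler_wpM2l (dual_vol_ball_ge0 _ _) mean).
  by rewrite le_eqVlt; apply/orP; left; apply/eqP; ring.
- move=> qd; rewrite /dual_dev /c1 (leNgt `|q|) qd /=.
  apply: le_trans (ler_wpM2l (kappa_ge0 _) mean).
  by rewrite le_eqVlt; apply/orP; left; apply/eqP; ring.
- move=> _; apply: le_trans (dual_dev0_ge m0 M0 kd poly P1 intP fM).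
  by rewrite cap_heightE le_eqVlt; apply/orP; left; apply/eqP; field.
Qed.
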